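(* For $1<p<\infty$ let $p'=p/(p-1)$ and $p^*=\max\{p,p'\}$, and let $C_g[\mathcal{H}^{(p)},L_p]$ be the greedy constant of the $L_p$-normalized Haar system $\mathcal{H}^{(p)}$ in $L_p=L_p[0,1]$. Then $C_g[\mathcal{H}^{(p)},L_p]\approx p^*$ for $1<p<\infty$; that is, there are constants $0<c\le C<\infty$, independent of $p$, such that \[ c\,p^*\le C_g[\mathcal{H}^{(p)},L_p]\le C\,p^*\qquad\text{for all } 1<p<\infty. \]
   Context: Scalars are $\mathbb{F}=\mathbb{R}$ or $\mathbb{C}$. Haar system. Let $\mathcal{D}$ be the collection of all dyadic intervals $I=[a,b)$ contained in $[0,1)$, and let $\mathcal{D}_0=\mathcal{D}\cup\{0\}$. The Haar system is $\mathcal{H}^{(p)}=(h_I^{(p)})_{I\in\mathcal{D}_0}$, where $h_0^{(p)}$ is the constant function $1$ on $[0,1)$ and, for $I=[a,b)\in\mathcal{D}$, $h_I^{(p)}$ is supported on $I$, equals $-(b-a)^{-1/p}$ on $[a,(a+b)/2)$ and equals $(b-a)^{-1/p}$ on $[(a+b)/2,b)$. It is a normalized $M$-bounded basis of $L_p$, with coordinate functionals $\mathcal{H}^{(p')}$ (under the canonical identification of $L_{p'}$ with $(L_p)^*$). Bases. A (Markushevich) basis of an infinite-dimensional separable Banach space $\mathbb{X}$ is a countable family $\mathcal{B}=(\mathbf{x}_j)_{j\in J}$ with closed linear span $\mathbb{X}$ for which there are (uniquely determined) functionals $\mathbf{x}_j^*\in\mathbb{X}^*$ (coordinate functionals) with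 $\mathbf{x}_j^*(\mathbf{x}_k)=\delta_{jk}$ and with weak$^*$-closed linear span $\mathbb{X}^*$. It is semi-normalized and $M$-bounded if and only if $\sup_j\max\{\|\mathbf{x}_j\|,\|\mathbf{x}_j^*\|\}<\infty$. Greedy algorithm. Let $\mathcal{B}$ be semi-normalized and $M$-bounded, and fix a bijection $\sigma\colon J\to\mathbb{N}$. For $f\in\mathbb{X}$ the family $(\mathbf{x}_j^*(f))_{j\in J}$ belongs to $c_0(J)$. The greedy ordering of $f$ is the unique one-to-one map $\rho\colon\mathbb{N}\to J$ such that $(|\mathbf{x}_{\rho(m)}^*(f)|)_{m}$ is the non-increasing rearrangement of $(|\mathbf{x}_j^*(f)|)_{j\in J}$, with ties resolved by $\sigma$ (i.e. $\sigma(\rho(m))\le\sigma(\rho(n))$ whenever $m\le n$ and $|\mathbf{x}_{\rho(m)}^*(f)|=|\mathbf{x}_{\rho(n)}^*(f)|$), and such that $\rho(\mathbb{N})=\{j:\mathbf{x}_j^*(f)\neq0\}$ if this set is infinite and $\rho(\mathbb{N})=J$ if it is finite. Put $\mathcal{G}_m(f)=\sum_{n=1}^m\mathbf{x}_{\rho(n)}^*(f)\,\mathbf{x}_{\rho(n)}$. Greedy constant. $C_g[\mathcal{B},\mathbb{X}]$ is the smallest constant $C\in[1,\infty]$ such that for all $m\in\mathbb{N}$, all $f\in\mathbb{X}$, all $A\subseteq J$ with $|A|=m$ and all scalars $(a_j)_{j\in A}$, \[ \|f-\mathcal{G}_m(f)\|\le C\Big\|f-\sum_{j\in A}a_j\mathbf{x}_j\Big\|.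 \] *)

(* Defs.v *)
From mathcomp Require Import all_boot all_order all_algebra finmap complex.
From mathcomp Require Import all_classical all_reals all_analysis.

Set Implicit Arguments.
Unset Strict Implicit.
Unset Printing Implicit Defensive.

Import Order.TTheory GRing.Theory Num.Theory.

Local Open Scope classical_set_scope.
Local Open Scope ring_scope.

Variant scalar_kind := RealScalars | ComplexScalars.

Definition scalar_field (R : realType) (F : scalar_kind) : numFieldType :=
  match F with
  | RealScalars => R : numFieldType
  | ComplexScalars => R[i] : numFieldType
  end.

Definition scalar_re (R : realType) (F : scalar_kind) : scalar_field R F -> R :=
  match F with
  | RealScalars => fun x => x
  | ComplexScalars => fun z => complex.Re z
  end.

Definition scalar_im (R : realType) (F : scalar_kind) : scalar_field R F -> R :=
  match F with
  | RealScalars => fun=> 0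
  | ComplexScalars => fun z => complex.Im z
  end.

(* a + i b; the second argument is dropped for real scalars. *)
Definition scalar_of_reim (R : realType) (F : scalar_kind) :
    R -> R -> scalar_field R F :=
  match F with
  | RealScalars => fun a _ => a
  | ComplexScalars => fun a b => Complex a b
  end.

(* The norm of a [numFieldType] takes values in the field itself; this is the
   same absolute value as an element of [R]. *)
Definition scalar_abs (R : realType) (F : scalar_kind) (z : scalar_field R F) :
    R :=
  scalar_re `|z|.

Section Greedy.
Context (R : realType) (K : numFieldType) (J : choiceType).

Definition is_greedy_ordering (sigma : J -> nat) (c : J -> K)
    (rho : nat -> J) : Prop :=
  [/\ injective rho,
      {homo (fun n => `|c (rho n)|) : m n / (m <= n)%N >-> n <= m},
      (forall m n, (m <= n)%N -> `|c (rho m)| = `|c (rho n)| ->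
        (sigma (rho m) <= sigma (rho n))%N),
      (infinite_set [set j | c j != 0] -> range rho = [set j | c j != 0]) &
      (finite_set [set j | c j != 0] -> range rho = [set: J])].

Context (V : lmodType K).

Definition greedy_sum (x : J -> V) (c : J -> K) (rho : nat -> J) (m : nat) :
    V :=
  \sum_(n < m) c (rho n) *: x (rho n).

Definition greedy_bound (X : set V) (N : V -> \bar R)
    (x : J -> V) (xs : J -> V -> K) (sigma : J -> nat) (C : R) : Prop :=
  forall (m : nat) (f : V) (rho : nat -> J) (A : {fset J}) (a : J -> K),
    X f -> is_greedy_ordering sigma (xs ^~ f) rho -> #|` A| = m ->
    (N (f - greedy_sum x (xs ^~ f) rho m)%R
       <= C%:E * N (f - \sum_(j <- A) a j *: x j)%R)%E.

(* The infimum is attained when finite, and it is [+oo] when no real constant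
   is admissible, so this is the smallest constant in [1, +oo]. *)
Definition greedy_constant (X : set V) (N : V -> \bar R)
    (x : J -> V) (xs : J -> V -> K) (sigma : J -> nat) : \bar R :=
  ereal_inf [set C%:E | C in
    [set C : R | 1 <= C /\ greedy_bound X N x xs sigma C]].

End Greedy.

Definition lebesgue01 (R : realType) :
    {measure set (measurableTypeR R) -> \bar R} :=
  mrestr (@lebesgue_measure R) (measurable_itv `[0%R, 1%R[).

Section Lp.
Context (R : realType) (F : scalar_kind).

Local Notation functions := (measurableTypeR R -> (scalar_field R F)^o).

(* Elements of L_p[0,1) are represented by functions on the whole line; the
   values outside [0,1) are not seen by [lebesgue01]. The regular module [^o]
   makes them an [lmodType] over the scalars. *)
Definition Lp_norm (p : R) (f : functions) : \bar R :=
  Lnorm (lebesgue01 R) p%:E (fun x => (scalar_abs (f x))%:E).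

Definition Lp_space (p : R) : set functions :=
  [set f | [/\ measurable_fun setT (fun x => scalar_re (f x)),
               measurable_fun setT (fun x => scalar_im (f x)) &
               (Lp_norm p f < +oo)%E]].

Definition scalar_integral (f : functions) : scalar_field R F :=
  scalar_of_reim F
    (Rintegral (lebesgue01 R) setT (fun x => scalar_re (f x)))
    (Rintegral (lebesgue01 R) setT (fun x => scalar_im (f x))).

End Lp.

(* The pair (n, k) with k < 2 ^ n encodes [k / 2 ^ n, (k + 1) / 2 ^ n). *)
Definition dyadic := {n : nat & 'I_(2 ^ n)}.

Section Haar.
Context (R : realType) (F : scalar_kind).

Local Notation functions := (measurableTypeR R -> (scalar_field R F)^o).

Definition dyadic_left (I : dyadic) : R := (tagged I)%:R / 2 ^+ tag I.
Definition dyadic_right (I : dyadic) : R := (tagged I).+1%:R / 2 ^+ tag I.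
Definition dyadic_mid (I : dyadic) : R :=
  (dyadic_left I + dyadic_right I) / 2.

Definition haar_real (p : R) (I : option dyadic) (x : R) : R :=
  match I with
  | None => if x \in `[0, 1[ then 1 else 0
  | Some D =>
      let a := dyadic_left D in
      let b := dyadic_right D in
      let c := dyadic_mid D in
      if x \in `[a, c[ then - ((b - a) `^ (- p^-1))
      else if x \in `[c, b[ then (b - a) `^ (- p^-1)
      else 0
  end.

Definition haar (p : R) (I : option dyadic) : functions :=
  fun x => scalar_of_reim F (haar_real p I x) 0.

Definition conj_exponent (p : R) : R := p / (p - 1).

Definition haar_functional (p : R) (I : option dyadic)
    (f : functions) : scalar_field R F :=
  scalar_integral (fun x => f x * haar (conj_exponent p) I x).

Definition haar_greedy_constant (p : R) (sigma : option dyadic -> nat) :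
    \bar R :=
  greedy_constant (@Lp_space R F p) (@Lp_norm R F p) (haar p)
    (haar_functional p) sigma.

End Haar.

(* Main.v *)
Require Import Defs.
From mathcomp Require Import all_boot all_order all_algebra finmap complex.
From mathcomp Require Import all_classical all_reals all_analysis.
From mathcomp Require Import measurable_realfun ring lra zify.

Set Implicit Arguments.
Unset Strict Implicit.
Unset Printing Implicit Defensive.

Import Order.TTheory GRing.Theory Num.Theory.

Local Open Scope classical_set_scope.
Local Open Scope ring_scope.

(** Write q for the conjugate exponent of p. Since p q = p + q, the numbers p q
    and max(p, q) are equivalent, and it suffices to bound the greedy constant
    above by a multiple of p q and below by a multiple of max(p, q).

    Upper bound. Let B be the set chosen by the greedy algorithm, A another set
    of the same size, and g = f - sum_A a_j h_j. With P_S the projection onto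
    the Haar functions indexed by S,
      f - P_B f = (g - P_(A u B) g) + P_(A minus B) f
    ([remainder_decomposition]), so two estimates are needed.

    - Projections have norm at most 10 p q ([haar_projection_Lnorm]). Passing
      to averages over dyadic intervals replaces functions by dyadic
      martingales. Test P_S g against a function in L_q: the pairing is at most
      the sum over dyadic I of |I| |d_I a| |d_I b|, where a and b are the
      martingales of g and of the test function, and that sum is at most ten
      times the mean of the product of the two maximal functions
      ([sum_half_jump_le_maximal]). The last fact is an induction on levels
      with the explicit Bellman function 8 m k + k x^2 / m + m y^2 / k
      ([bellman_step]). Doob's inequality ([doob_maximal]), with constant q in
      L_p and constant p in L_q, gives the factor p q for all p at once.

    - A sum over a finite set A of multiples c_I h_I with all |c_I| <= t has
      norm at most 32 p q times the norm of g, when at least as many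
      coefficients of g have modulus at least t ([haar_sum_le_Lnorm]). At a
      fixed point the sizes of the Haar functions form a lacunary sequence of
      ratio 2^(1/p), hence the p-th power of their sum is at most (8 p)^p times
      the sum of their p-th powers ([powR_sum_lacunary]); this costs a factor of
      order p. Conversely a coefficient of modulus at least t at I makes the
      dyadic maximal function of |g| at least a multiple of t |I|^(-1/p) on I,
      and Doob's inequality costs a factor q ([size_le_maximal]).

    Complex scalars are handled through real and imaginary parts.

    Lower bound. Compare the n intervals [0, 2^-k), k < n, with n disjoint
    intervals of equal length. Doubling the coefficients on one of these two
    families forces the greedy algorithm to select it first, so the greedy
    constant is at least half the quotient of the norms of the two sums, in
    either order ([greedy_bound_disjoint]). The disjoint sum has norm n^(1/p).
    The nested sum has norm at least n^(1/p) p / 16 for a suitable n if p >= 2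
    ([Lnorm01_nested_lower]), because its terms accumulate, and at most
    16 n^(1/p) / q for a suitable n if p <= 2 ([Lnorm01_nested_upper]), because
    near p = 1 it almost telescopes. *)

(** * Dyadic martingales and Doob's maximal inequality *)

Section DyadicMartingales.
Context {R : realType}.
Implicit Types (F G : nat -> R) (a b : nat -> nat -> R) (n k N : nat).

Definition level_mean n F : R := 2^-1 ^+ n * \sum_(k < 2 ^ n) F k.

(** The intervals [k.*2] and [k.*2.+1] of level [n.+1] are the halves of interval
    [k] of level [n]. *)
Definition is_martingale N a : Prop :=
  forall n k, (n < N)%N -> a n k = (a n.+1 k.*2 + a n.+1 k.*2.+1) / 2.

Definition half_jump a n k : R := (a n.+1 k.*2.+1 - a n.+1 k.*2) / 2.

Fixpoint running_max a n k : R :=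
  if n is n'.+1 then Num.max (running_max a n' k./2) `|a n k| else `|a 0%N k|.

Lemma sum_pairs m F :
  \sum_(k < m.*2) F k = \sum_(k < m) (F k.*2 + F k.*2.+1).
Proof.
elim: m => [|m IH]; first by rewrite !big_ord0.
by rewrite doubleS !big_ord_recr /= IH addrA.
Qed.

Lemma level_mean0 F : level_mean 0 F = F 0%N.
Proof. by rewrite /level_mean expr0 mul1r big_ord1. Qed.

Lemma level_meanS n F :
  level_mean n.+1 F = level_mean n (fun k => (F k.*2 + F k.*2.+1) / 2).
Proof.
rewrite /level_mean expnS mul2n sum_pairs exprSr -mulrA; congr (_ * _).
by rewrite mulr_sumr; apply: eq_bigr => i _; rewrite mulrC.
Qed.

Lemma eq_level_mean n F G : (forall k, (k < 2 ^ n)%N -> F k = G k) ->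
  level_mean n F = level_mean n G.
Proof. by move=> h; rewrite /level_mean; congr (_ * _); apply: eq_bigr => i _;
  apply: h. Qed.

Lemma level_meanD n F G :
  level_mean n (fun k => F k + G k) = level_mean n F + level_mean n G.
Proof. by rewrite /level_mean big_split mulrDr. Qed.

Lemma level_meanZ n c F : level_mean n (fun k => c * F k) = c * level_mean n F.
Proof. by rewrite /level_mean -mulr_sumr mulrCA. Qed.

Lemma level_mean_sum (I : Type) (r : seq I) (P : pred I) (F : I -> nat -> R) n :
  level_mean n (fun k => \sum_(i <- r | P i) F i k) =
  \sum_(i <- r | P i) level_mean n (F i).
Proof. by rewrite /level_mean exchange_big /= mulr_sumr. Qed.

Lemma ler_level_mean n F G : (forall k, (k < 2 ^ n)%N -> F k <= G k) ->
  level_mean n F <= level_mean n G.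
Proof.
move=> h; apply: ler_wpM2l; first by rewrite exprn_ge0 // invr_ge0.
by apply: ler_sum => i _; apply: h.
Qed.

Lemma level_mean_ge0 n F : (forall k, 0 <= F k) -> 0 <= level_mean n F.
Proof.
move=> h; apply: mulr_ge0; first by rewrite exprn_ge0 // invr_ge0.
by apply: sumr_ge0 => i _; apply: h.
Qed.

Lemma level_mean_halfn n F :
  level_mean n.+1 (fun k => F k./2) = level_mean n F.
Proof.
rewrite level_meanS; apply: eq_level_mean => k _.
by rewrite doubleK /= uphalf_double; lra.
Qed.

Lemma level_mean_supermartingale (F : nat -> nat -> R) N :
  (forall n k, (n < N)%N -> (F n.+1 k.*2 + F n.+1 k.*2.+1) / 2 <= F n k) ->
  level_mean N (F N) <= F 0%N 0%N.
Proof.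
elim: N => [|N IH] h; first by rewrite level_mean0.
rewrite level_meanS; apply: le_trans (IH _); last first.
  by move=> n k nN; apply: h; rewrite ltnS ltnW.
by apply: ler_level_mean => k _; apply: h.
Qed.

Lemma running_max_ge a n k : `|a n k| <= running_max a n k.
Proof. by case: n => [|n] /=; rewrite ?le_max ?lexx ?orbT. Qed.

Lemma running_max_ge0 a n k : 0 <= running_max a n k.
Proof. exact: le_trans (running_max_ge a n k). Qed.

Lemma conjugate_mulB1 (p q : R) : 0 < p -> 0 < q -> p^-1 + q^-1 = 1 ->
  (p - 1) * q = p.
Proof.
move=> p0 q0 pq.
have : (p^-1 + q^-1) * (p * q) = q + p by field; rewrite !gt_eqF.
by rewrite pq; lra.
Qed.

(** The process m^p - q m^(p-1) |x| does not increase when the maximum m is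
    updated: if |y| <= m nothing changes, otherwise this is Young's inequality
    for m^(p-1) and |y|. *)
Lemma doob_step (p q m y : R) : 1 < p -> p^-1 + q^-1 = 1 -> 0 < q -> 0 <= m ->
  Num.max m `|y| `^ p - q * Num.max m `|y| `^ (p - 1) * `|y| <=
  m `^ p - q * m `^ (p - 1) * `|y|.
Proof.
move=> p1 pq q0 m0; have p0 : 0 < p by lra.
case: (leP `|y| m) => ym //.
have t0 : 0 <= `|y| by [].
set t := `|y| in ym t0 *.
have pq' := conjugate_mulB1 p0 q0 pq.
have := conjugate_powR (powR_ge0 m (p - 1)) t0 q0 p0.
rewrite addrC => /(_ pq); rewrite -powRrM pq' => yg.
rewrite -mulrA -[t `^ (p - 1) * t]mulrC mulr_powRB1//.
have : q * (m `^ (p - 1) * t) <= q * (m `^ p / q + t `^ p / p).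
  by rewrite ler_pM2l.
have -> : q * (m `^ p / q + t `^ p / p) = m `^ p + (q - 1) * t `^ p.
  have -> : p^-1 = 1 - q^-1 by lra.
  by field; rewrite gt_eqF.
by rewrite mulrA; lra.
Qed.

(** By [doob_step] the mean of m^p - q m^(p-1) |x| decreases along the levels and
    starts at a nonpositive value; Young's inequality applied to the product
    m^(p-1) (q |x|) then isolates the mean of m^p. *)
Lemma doob_maximal (p q : R) N a : 1 < p -> 0 < q -> p^-1 + q^-1 = 1 ->
  is_martingale N a ->
  level_mean N (fun k => running_max a N k `^ p) <=
  q `^ p * level_mean N (fun k => `|a N k| `^ p).
Proof.
move=> p1 q0 pq mart; have p0 : 0 < p by lra.
pose W n k := running_max a n k `^ p
               - q * running_max a n k `^ (p - 1) * `|a n k|.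
have q1 : 1 <= q.
  have pV0 : 0 < p^-1 by rewrite invr_gt0.
  by rewrite -invf_le1//; lra.
have W0 : W 0%N 0%N <= 0.
  rewrite /W /= -mulrA [X in q * X]mulrC mulr_powRB1// -{1}[_ `^ p]mul1r -mulrBl.
  by rewrite mulr_le0_ge0 ?powR_ge0//; lra.
have step n k : (n < N)%N -> (W n.+1 k.*2 + W n.+1 k.*2.+1) / 2 <= W n k.
  move=> nN; rewrite /W /= doubleK uphalf_double.
  have M0 := running_max_ge0 a n k.
  have h1 := doob_step (a n.+1 k.*2) p1 pq q0 M0.
  have h2 := doob_step (a n.+1 k.*2.+1) p1 pq q0 M0.
  have h3 : `|a n k| <= (`|a n.+1 k.*2| + `|a n.+1 k.*2.+1|) / 2.
    rewrite mart // normrM [ `|2^-1|]ger0_norm ?invr_ge0//.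
    by rewrite ler_pM2r ?invr_gt0// ler_normD.
  have h4 : 0 <= q * running_max a n k `^ (p - 1).
    by rewrite mulr_ge0 ?powR_ge0// ltW.
  have := ler_wpM2l h4 h3.
  move: h1 h2; set A := Num.max _ _; set B := Num.max _ _; lra.
have WN : level_mean N (W N) <= 0 := le_trans (level_mean_supermartingale step) W0.
set X := level_mean N _; set Y := level_mean N _.
have pqm : p * (1 - q^-1) = 1 by rewrite -pq addrK mulfV ?gt_eqF.
have : level_mean N (fun k => (1 - q^-1) * running_max a N k `^ p
         + - (p^-1 * q `^ p) * `|a N k| `^ p) <= level_mean N (W N).
  apply: ler_level_mean => k _; rewrite /W.
  set M := running_max a N k; set t := `|a N k|.
  have M0 : 0 <= M := running_max_ge0 a N k.
  have t0 : 0 <= q * t by apply: mulr_ge0 => [|]; [exact: ltW|exact: normr_ge0].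
  have := conjugate_powR (powR_ge0 M (p - 1)) t0 q0 p0.
  rewrite addrC => /(_ pq); rewrite -powRrM.
  rewrite (conjugate_mulB1 p0 q0 pq).
  by rewrite (powRM _ (ltW q0)) ?normr_ge0 //; lra.
rewrite level_meanD !level_meanZ -/X -/Y => h.
have {h WN} : (1 - q^-1) * X <= p^-1 * q `^ p * Y by lra.
have -> : 1 - q^-1 = p^-1 by lra.
by rewrite -mulrA ler_pM2l ?invr_gt0.
Qed.
End DyadicMartingales.

(** * A Bellman function for products of martingale differences *)

Section Bellman.
Context {R : realType}.

(** Here [x], [y] are the values of two martingales and [m], [k] their running
    maxima. The quadratic terms produce the product of the jumps, the first term
    pays for the growth of the maxima. *)
Definition bellman (x y m k : R) : R :=
  8 * m * k + k * (x ^+ 2 / m) + m * (y ^+ 2 / k).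

Let M (x : R) := Num.max 1 `|x|.

Lemma bellman_ge_prod (x y m k : R) : 0 <= m -> 0 <= k ->
  8 * (m * k) <= bellman x y m k.
Proof.
move=> m0 k0; rewrite /bellman.
have h1 : 0 <= k * (x ^+ 2 / m) by rewrite mulr_ge0// divr_ge0// sqr_ge0.
have h2 : 0 <= m * (y ^+ 2 / k) by rewrite mulr_ge0// divr_ge0// sqr_ge0.
lra.
Qed.

(** With maxima updated from 1, the Bellman function stays above the quadratic
    8 + x^2 + y^2 as long as the arguments do not exceed 8; this is what makes
    jumps of moderate size harmless. *)
Lemma bellman_ge_quadratic (x y : R) : `|x| <= 8 -> `|y| <= 8 ->
  8 + x ^+ 2 + y ^+ 2 <= bellman x y (M x) (M y).
Proof.
move=> x8 y8; rewrite /bellman /M -[x ^+ 2]real_normK ?num_real// -[y ^+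
  2]real_normK ?num_real//.
have := normr_ge0 x; have := normr_ge0 y.
move: `|x| `|y| x8 y8 => {x y} x y x8 y8 y0 x0.
case: (leP x 1) => x1; case: (leP y 1) => y1; rewrite ?divr1 ?mulr1.
- lra.
- have -> : y ^+ 2 / y = y by rewrite expr2 mulfK ?gt_eqF//; lra.
  have h0 := sqr_ge0 x.
  have h1 : 0 <= (y - 1) * x ^+ 2 by apply: mulr_ge0 => //; lra.
  have h2 : 0 <= (y - 1) * (8 - y) by apply: mulr_ge0 => //; lra.
  rewrite expr2 in h0 h1 *; nra.
- have -> : x ^+ 2 / x = x by rewrite expr2 mulfK ?gt_eqF//; lra.
  have h0 := sqr_ge0 y.
  have h1 : 0 <= (x - 1) * y ^+ 2 by apply: mulr_ge0 => //; lra.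
  have h2 : 0 <= (x - 1) * (8 - x) by apply: mulr_ge0 => //; lra.
  rewrite expr2 in h0 h1 *; nra.
have -> : y ^+ 2 / y = y by rewrite expr2 mulfK ?gt_eqF//; lra.
have -> : x ^+ 2 / x = x by rewrite expr2 mulfK ?gt_eqF//; lra.
have h1 : 0 <= (x - 1) * (8 - x) by apply: mulr_ge0 => //; lra.
have h2 : 0 <= (y - 1) * (8 - y) by apply: mulr_ge0 => //; lra.
have h3 : 0 <= (x - 1) * (y - 1) by apply: mulr_ge0 => //; lra.
nra.
Qed.

(** A jump of size more than 7 makes both updated maxima comparable with it, so
    the product of the maxima alone dominates. *)
Lemma bellman_large_jump (x y d e : R) : `|x| <= 1 -> `|y| <= 1 -> 7 < `|d| ->
  2 * (8 + x ^+ 2 + y ^+ 2) + 2 * (`|d| * `|e|) <=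
  8 * (M (x + d) * M (y + e)) + 8 * (M (x - d) * M (y - e)).
Proof.
move=> x1 y1 d7.
have x2 : x ^+ 2 <= 1 by rewrite -real_normK ?num_real// exprn_ile1.
have y2 : y ^+ 2 <= 1 by rewrite -real_normK ?num_real// exprn_ile1.
have M1 (z : R) : 1 <= M z by rewrite /M le_max lexx.
have Mge (z : R) : `|z| <= M z by rewrite /M le_max lexx orbT.
have hp : `|d| - 1 <= M (x + d).
  apply: le_trans (Mge _); have := ler_normB (x + d) x.
  by rewrite addrC addKr; lra.
have hm : `|d| - 1 <= M (x - d).
  apply: le_trans (Mge _); have := ler_normB x (x - d).
  by rewrite opprB addrC subrK; lra.
have [e2|e2] := leP `|e| 2.
  have kp := M1 (y + e); have km := M1 (y - e).
  have p1 : M (x + d) <= M (x + d) * M (y + e) by rewrite ler_peMr//; lra.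
  have p2 : M (x - d) <= M (x - d) * M (y - e) by rewrite ler_peMr//; lra.
  have p3 : `|d| * `|e| <= `|d| * 2 by rewrite ler_wpM2l.
  lra.
have kp : `|e| - 1 <= M (y + e).
  apply: le_trans (Mge _); have := ler_normB (y + e) y.
  by rewrite addrC addKr; lra.
have km : `|e| - 1 <= M (y - e).
  apply: le_trans (Mge _); have := ler_normB y (y - e).
  by rewrite opprB addrC subrK; lra.
have p1 : (`|d| - 1) * (`|e| - 1) <= M (x + d) * M (y + e).
  by apply: ler_pM => //; lra.
have p2 : (`|d| - 1) * (`|e| - 1) <= M (x - d) * M (y - e).
  by apply: ler_pM => //; lra.
have p3 : 0 <= (`|d| - 7) * (`|e| - 2) by apply: mulr_ge0; lra.
nra.
Qed.

(** For moderate jumps average [bellman_ge_quadratic] over the two branches: the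
    cross terms cancel and d^2 + e^2 remains. *)
Lemma bellman_step_normalized (x y d e : R) : `|x| <= 1 -> `|y| <= 1 ->
  2 * (8 + x ^+ 2 + y ^+ 2) + 2 * (`|d| * `|e|) <=
  bellman (x + d) (y + e) (M (x + d)) (M (y + e)) +
  bellman (x - d) (y - e) (M (x - d)) (M (y - e)).
Proof.
move=> x1 y1.
have M0 (z : R) : 0 <= M z by rewrite /M le_max ler01.
have B u v := bellman_ge_prod u v (M0 u) (M0 v).
have [d7|d7] := ltP 7 `|d|.
  have := bellman_large_jump e x1 y1 d7.
  have := B (x + d) (y + e); have := B (x - d) (y - e); lra.
have [e7|e7] := ltP 7 `|e|.
  have := bellman_large_jump d y1 x1 e7.
  have := B (x + d) (y + e); have := B (x - d) (y - e).
  rewrite [M (y + e) * _]mulrC [M (y - e) * _]mulrC [ `|e| * _]mulrC; lra.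
have n1 := ler_normD x d; have n2 := ler_normB x d.
have n3 := ler_normD y e; have n4 := ler_normB y e.
have := @bellman_ge_quadratic (x + d) (y + e); have :=
  @bellman_ge_quadratic (x - d) (y - e).
move=> /(_ _ _)/[swap] /(_ _ _) h1 h2.
have {}h1 := h1 ltac:(lra) ltac:(lra).
have {}h2 := h2 ltac:(lra) ltac:(lra).
have := sqr_ge0 (`|d| - `|e|).
have := real_normK (num_real d); have := real_normK (num_real e).
rewrite sqrrB; move: h1 h2; rewrite !sqrrB !sqrrD.
have de0 : 0 <= `|d| * `|e| by rewrite mulr_ge0.
rewrite !mulr2n => h1 h2 h3 h4 h5; lra.
Qed.

Lemma bellman_scale (x y m k s t : R) : 0 < m -> 0 < k -> s != 0 -> t != 0 ->
  bellman (m * x) (k * y) (m * s) (k * t) = m * k * bellman x y s t.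
Proof.
by move=> m0 k0 s0 t0; rewrite /bellman; field; rewrite s0 t0 !gt_eqF.
Qed.

(** The Bellman function gains the product of the jumps at every step. The case
    of positive maxima reduces by homogeneity to maxima equal to 1; a maximum
    equal to 0 forces the current value to be 0, and then the product of the new
    maxima is already large enough. *)
Lemma bellman_step (x y d e m k : R) : `|x| <= m -> `|y| <= k ->
  bellman x y m k + `|d| * `|e| <=
  (bellman (x + d) (y + e) (Num.max m `|x + d|) (Num.max k `|y + e|) +
   bellman (x - d) (y - e) (Num.max m `|x - d|) (Num.max k `|y - e|)) / 2.
Proof.
move=> xm yk.
have m0 : 0 <= m by apply: le_trans xm.
have k0 : 0 <= k by apply: le_trans yk.
have X0 (a b : R) : 0 <= a -> 0 <= Num.max a `|b| by move=> a0; rewrite le_max a0.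
have B := bellman_ge_prod (x + d) (y + e) (X0 m (x + d) m0) (X0 k (y + e) k0).
have B' := bellman_ge_prod (x - d) (y - e) (X0 m (x - d) m0) (X0 k (y - e) k0).
have dd : 2 * `|d| <= `|x + d| + `|x - d|.
  have := ler_normB (x + d) (x - d).
  have -> : x + d - (x - d) = d *+ 2 by rewrite mulr2n; ring.
  by rewrite normrMn mulr2n; lra.
have ee : 2 * `|e| <= `|y + e| + `|y - e|.
  have := ler_normB (y + e) (y - e).
  have -> : y + e - (y - e) = e *+ 2 by rewrite mulr2n; ring.
  by rewrite normrMn mulr2n; lra.
have Mx (a b : R) : `|b| <= Num.max a `|b| by rewrite le_max lexx orbT.
have := Mx m (x + d); have := Mx m (x - d); have := Mx k (y + e); have :=
  Mx k (y - e).
move: m0; rewrite le_eqVlt => /predU1P[m0|m0].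
  subst m; have {xm} ? : x = 0 by apply/eqP; rewrite -normr_le0.
  subst x; have -> : bellman 0 y 0 k = 0 by rewrite /bellman expr0n /=; ring.
  move: B B'; rewrite !add0r normrN.
  have -> : Num.max 0 `|d| = `|d| by apply/max_idPr.
  move=> B B' h1 h2 _ _.
  have : `|d| * (2 * `|e|) <= `|d| * (Num.max k `|y + e| + Num.max k `|y - e|).
    by apply: ler_wpM2l => //; lra.
  have : 0 <= `|d| * `|e| by rewrite mulr_ge0.
  lra.
move: k0; rewrite le_eqVlt => /predU1P[k0|k0].
  subst k; have {yk} ? : y = 0 by apply/eqP; rewrite -normr_le0.
  subst y; have -> : bellman x 0 m 0 = 0 by rewrite /bellman expr0n /=; ring.
  move: B B'; rewrite !add0r normrN.
  have -> : Num.max 0 `|e| = `|e| by apply/max_idPr.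
  move=> B B' _ _ h1 h2.
  have : `|e| * (2 * `|d|) <= `|e| * (Num.max m `|x + d| + Num.max m `|x - d|).
    by apply: ler_wpM2l => //; lra.
  have : 0 <= `|d| * `|e| by rewrite mulr_ge0.
  lra.
move=> _ _ _ _ {B B' dd ee}.
have norm_le1 (a b : R) : 0 < b -> `|a| <= b -> `|a / b| <= 1.
  by move=> b0 ab; rewrite normrM normfV (gtr0_norm b0) ler_pdivrMr// mul1r.
have := bellman_step_normalized (d / m) (e / k) (norm_le1 _ _ m0 xm) (norm_le1 _ _
  k0 yk).
have scM (a z : R) : 0 < a -> Num.max a `|z| = a * M (z / a).
  move=> a0; rewrite /M maxr_pMr ?ltW// mulr1.
  by rewrite normrM normfV (gtr0_norm a0) mulrCA mulfV ?mulr1// gt_eqF.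
have Mn0 (z : R) : M z != 0 by rewrite gt_eqF// /M lt_max ltr01.
rewrite !scM//.
have E (a b : R) : bellman a b (m * M (a / m)) (k * M (b / k)) =
    m * k * bellman (a / m) (b / k) (M (a / m)) (M (b / k)).
  rewrite -bellman_scale//.
  by rewrite (mulrCA m) (mulrCA k) !mulfV ?mulr1 ?gt_eqF.
rewrite !E !mulrDl !mulNr.
have mk : 0 < m * k by rewrite mulr_gt0.
rewrite -(ler_pM2l mk).
have -> : bellman x y m k = m * k * (8 + (x / m) ^+ 2 + (y / k) ^+ 2).
  by rewrite /bellman; field; rewrite !gt_eqF.
have -> : `|d| = m * `|d / m|.
  by rewrite normrM normfV (gtr0_norm m0) mulrCA mulfV ?mulr1// gt_eqF.
have -> : `|e| = k * `|e / k|.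
  by rewrite normrM normfV (gtr0_norm k0) mulrCA mulfV ?mulr1// gt_eqF.
have -> : m * `|d / m| * (k * `|e / k|) = m * k * (`|d / m| * `|e / k|) by ring.
lra.
Qed.

End Bellman.

(** * Pairing two martingales through their differences *)

Section Pairing.
Context {R : realType}.
Implicit Types (a b : nat -> nat -> R) (n k N : nat).

Lemma half_jumpP N a n k : is_martingale N a -> (n < N)%N ->
  a n.+1 k.*2.+1 = a n k + half_jump a n k /\
  a n.+1 k.*2 = a n k - half_jump a n k.
Proof. by move=> ma nN; rewrite (ma _ _ nN) /half_jump; split; lra. Qed.

(** Summing [bellman_step] over all levels, and bounding the final value of the
    Bellman function by ten times the product of the maxima. *)
Lemma sum_half_jump_le_maximal N a b : is_martingale N a -> is_martingale N b ->
  `|a 0 0| * `|b 0 0| +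
    \sum_(n < N) level_mean n (fun k => `|half_jump a n k| * `|half_jump b n k|) <=
  10 * level_mean N (fun k => running_max a N k * running_max b N k).
Proof.
move=> ma mb.
pose D n k := bellman (a n k) (b n k) (running_max a n k) (running_max b n k).
have chain L : (L <= N)%N -> `|a 0 0| * `|b 0 0| +
    \sum_(n < L) level_mean n (fun k => `|half_jump a n k| * `|half_jump b n k|) <=
    level_mean L (D L).
  elim: L => [_|L IH LN].
    rewrite big_ord0 addr0 level_mean0 /D /=.
    have := bellman_ge_prod (a 0 0) (b 0 0) (normr_ge0 (a 0 0)) (normr_ge0 (b 0 0)).
    have : 0 <= `|a 0 0| * `|b 0 0| by rewrite mulr_ge0.
    lra.
  rewrite big_ord_recr /= addrA; apply: le_trans (_ : _ <= level_mean L (D L) + _)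
    _.
    by apply: lerD; [apply: IH; exact: ltnW|].
  rewrite -level_meanD level_meanS; apply: ler_level_mean => k _.
  have [ea1 ea2] := half_jumpP k ma LN; have [eb1 eb2] := half_jumpP k mb LN.
  rewrite /D /= doubleK uphalf_double ea1 ea2 eb1 eb2 [X in _ <= X / 2]addrC.
  by apply: bellman_step; exact: running_max_ge.
apply: le_trans (chain N (leqnn N)) _.
rewrite -level_meanZ; apply: ler_level_mean => k _; rewrite /D /bellman.
set m := running_max a N k; set l := running_max b N k.
have m0 : 0 <= m := running_max_ge0 a N k.
have l0 : 0 <= l := running_max_ge0 b N k.
have H (z c : R) : `|z| <= c -> z ^+ 2 / c <= c.
  move=> zc; have : 0 <= c by apply: le_trans zc.
  rewrite le_eqVlt => /predU1P[<-|c0]; first by rewrite invr0 mulr0.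
  by rewrite ler_pdivrMr// -expr2 -real_normK ?num_real// lerXn2r ?nnegrE// ltW.
have := ler_wpM2l l0 (H _ _ (running_max_ge a N k)).
have := ler_wpM2l m0 (H _ _ (running_max_ge b N k)).
rewrite -/m -/l; lra.
Qed.

(** Meaningful for levels up to [N]; the subtraction being truncated, higher
    levels repeat [g]. *)
Definition martingale_of N (g : nat -> R) n : nat -> R :=
  iter (N - n) (fun v k => (v k.*2 + v k.*2.+1) / 2) g.

Lemma martingale_ofP N g : is_martingale N (martingale_of N g).
Proof.
by move=> n k nN; rewrite /martingale_of (_ : (N - n = (N - n.+1).+1)%N) //; lia.
Qed.

Lemma martingale_of_top N g : martingale_of N g N = g.
Proof. by rewrite /martingale_of subnn. Qed.

(** Averaging the martingale over the descendants of an interval gives its value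
    there: [k %/ 2 ^ (N - n)] is the interval of level [n] that contains the
    interval [k] of level [N]. *)
Lemma level_mean_ancestor N n a (F : nat -> R) : is_martingale N a -> (n <= N)%N ->
  level_mean N (fun k => F (k %/ 2 ^ (N - n))%N * a N k) =
  level_mean n (fun k => F k * a n k).
Proof.
elim: N => [|N IH] ma; first by rewrite leqn0 => /eqP->; apply: eq_level_mean =>
  k _; rewrite divn1.
rewrite leq_eqVlt => /predU1P[->|].
  by apply: eq_level_mean => k _; rewrite subnn divn1.
rewrite ltnS => nN; rewrite -IH// => [|i k iN]; last by apply: ma; exact: ltnW.
rewrite level_meanS; apply: eq_level_mean => k _.
rewrite subSn// expnS 2!divnMA !divn2 doubleK /= uphalf_double (ma N k (ltnSn N)).
lra.
Qed.

Lemma level_mean_martingale N n a : is_martingale N a -> (n <= N)%N ->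
  level_mean N (a N) = level_mean n (a n).
Proof.
move=> ma nN; have := level_mean_ancestor (fun=> 1) ma nN.
under eq_level_mean do rewrite mul1r.
by move=> ->; apply: eq_level_mean => k _; rewrite mul1r.
Qed.

Lemma is_martingale1 N : is_martingale N (fun _ _ => 1 : R).
Proof. by move=> n k _; lra. Qed.

Lemma running_max_ancestor N n a k : (n <= N)%N ->
  running_max a n (k %/ 2 ^ (N - n))%N <= running_max a N k.
Proof.
elim: N k => [|N IH] k; first by rewrite leqn0 => /eqP->; rewrite divn1.
rewrite leq_eqVlt => /predU1P[->|]; first by rewrite subnn divn1.
rewrite ltnS => nN; rewrite /= le_max; apply/orP; left.
by rewrite subSn// expnS divnMA divn2 IH.
Qed.

(** Sign of the Haar function of interval [j] on interval [c] of the next level,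
    where [j.*2] and [j.*2.+1] are the left and right halves of [j]. *)
Definition haar_sign (j c : nat) : R := (c == j.*2.+1)%:R - (c == j.*2)%:R.

Lemma norm_haar_sign j c : `|haar_sign j c| = (c./2 == j)%:R.
Proof.
have [h|h] := eqVneq c./2 j; rewrite /haar_sign.
  rewrite -[c]odd_double_half h; case: (odd c); rewrite ?add0n ?add1n ?eqxx.
    have -> : (j.*2.+1 == j.*2) = false by apply/negbTE; lia.
    by rewrite subr0 normr1.
  have -> : (j.*2 == j.*2.+1) = false by apply/negbTE; lia.
  by rewrite sub0r normrN1.
have -> : (c == j.*2.+1) = false.
  by apply: contra_neqF h => /eqP->; rewrite /= uphalf_double.
have -> : (c == j.*2) = false by apply: contra_neqF h => /eqP->; rewrite doubleK.
by rewrite subrr normr0.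
Qed.

Lemma level_mean_delta n j (F : nat -> R) : (j < 2 ^ n)%N ->
  level_mean n (fun k => (k == j)%:R * F k) = 2^-1 ^+ n * F j.
Proof.
move=> jn; rewrite /level_mean (bigD1 (Ordinal jn)) //= eqxx mul1r big1 ?addr0//.
by move=> i /negbTE; rewrite -val_eqE /= => ->; rewrite mul0r.
Qed.

Lemma haar_pairing N n j a : is_martingale N a -> (n < N)%N -> (j < 2 ^ n)%N ->
  level_mean N (fun k => haar_sign j (k %/ 2 ^ (N - n.+1))%N * a N k) =
  2^-1 ^+ n * half_jump a n j.
Proof.
move=> ma nN jn; rewrite level_mean_ancestor// level_meanS -level_mean_delta//.
apply: eq_level_mean => k _; rewrite /haar_sign /half_jump.
have -> : (k.*2 == j.*2.+1) = false by apply/negbTE; lia.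
have -> : (k.*2.+1 == j.*2) = false by apply/negbTE; lia.
rewrite eqSS; have -> : (k.*2 == j.*2) = (k == j) by rewrite -!mul2n eqn_pmul2l.
by case: (k == j) => /=; lra.
Qed.

End Pairing.

(** * Haar functions as functions of a dyadic interval of high level *)

Section HaarSums.
Context {R : realType}.
Implicit Types (a b : nat -> nat -> R) (n k N : nat) (I : option dyadic).

(** The constant function has level 0 and the intervals of length 2^-n have level
    n + 1, so that [haar_level I <= N] says that the Haar function is constant on
    the intervals of level [N]. In both cases [(haar_level I).-1] is the level
    of the support. *)
Definition haar_level I : nat := if I is Some D then (tag D).+1 else 0.
Definition haar_pos I : nat := if I is Some D then tagged D else 0.

(** Haar function divided by its modulus on the support, on interval [k] of
    level [N]. *)
Definition haar_cell N I k : R :=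
  if I is Some D then haar_sign (tagged D) (k %/ 2 ^ (N - (tag D).+1))%N else 1.

(** Coefficient with respect to the functions [haar_cell], of modulus 1 on their
    supports. *)
Definition haar_coef a I : R :=
  if I is Some D then half_jump a (tag D) (tagged D) else a 0 0.

Definition haar_mass I : R := 2^-1 ^+ (haar_level I).-1.

Lemma haar_mass_gt0 I : 0 < haar_mass I.
Proof. by rewrite exprn_gt0 // invr_gt0. Qed.

Lemma haar_level_pos_inj I I' :
  haar_level I = haar_level I' -> haar_pos I = haar_pos I' -> I = I'.
Proof.
case: I => [[n i]|]; case: I' => [[m j]|] //= [e]; move: j; rewrite -e => j h.
by congr (Some (existT _ _ _)); apply: val_inj.
Qed.

Lemma norm_haar_cell N I k : (haar_level I <= N)%N -> (k < 2 ^ N)%N ->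
  `|haar_cell N I k| = (k %/ 2 ^ (N - (haar_level I).-1) == haar_pos I)%N%:R.
Proof.
case: I => [[n j]|] /= nN kN; last first.
  by rewrite normr1 subn0 divn_small// eqxx.
by rewrite norm_haar_sign -divn2 -divnMA -expnSr -subSn// subSS.
Qed.

Lemma haar_cell_pairing N I a : is_martingale N a -> (haar_level I <= N)%N ->
  level_mean N (fun k => haar_cell N I k * a N k) = haar_mass I * haar_coef a I.
Proof.
case: I => [[n j]|] /= ma nN; first by rewrite haar_pairing.
under eq_level_mean do rewrite mul1r.
by rewrite (level_mean_martingale ma (leq0n N)) level_mean0 /haar_mass expr0 mul1r.
Qed.

Lemma norm_haar_cell_pairing N I a : is_martingale N a -> (haar_level I <= N)%N ->
  level_mean N (fun k => `|haar_cell N I k| * a N k) =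
  haar_mass I * a (haar_level I).-1 (haar_pos I).
Proof.
move=> ma IN.
rewrite -level_mean_delta; last by case: I {IN} => [[n j]|] //=; exact: ltn_ord.
rewrite -(level_mean_ancestor (fun k => (k == haar_pos I)%:R) ma); last first.
  by apply: leq_trans IN; exact: leq_pred.
by apply: eq_level_mean => k kN; rewrite norm_haar_cell.
Qed.

Lemma level_mean_norm_haar N I : (haar_level I <= N)%N ->
  level_mean N (fun k => `|haar_cell N I k|) = haar_mass I.
Proof.
move=> IN; rewrite -[RHS]mulr1 -(norm_haar_cell_pairing (@is_martingale1 R N) IN).
by apply: eq_level_mean => k _; rewrite mulr1.
Qed.

Definition haar_indices N : seq (option dyadic) :=
  None :: [seq Some (Tagged (fun n => 'I_(2 ^ n)) j) | n <- iota 0 N,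
    j <- enum 'I_(2 ^ n)].

Lemma haar_indices_uniq N : uniq (haar_indices N).
Proof.
rewrite /haar_indices /=; apply/andP; split; first by apply/negP =>
  /allpairsPdep[n [j [_ _]]].
apply: allpairs_uniq_dep => [|n _|]; [exact: iota_uniq|exact: enum_uniq|].
move=> [n i] [m j] _ _ /= [nm]; subst m => /eqP; rewrite eq_Tagged /= => /eqP ->.
by [].
Qed.

Lemma mem_haar_indices N I : (haar_level I <= N)%N -> I \in haar_indices N.
Proof.
case: I => [[n j]|] h; rewrite inE //=.
by apply/allpairsPdep; exists n, j; rewrite mem_iota mem_enum.
Qed.

Lemma sum_haar_indices N (F : option dyadic -> R) :
  \sum_(I <- haar_indices N) F I =
  F None + \sum_(n < N) \sum_(j < 2 ^ n) F (Some (Tagged (fun n => 'I_(2 ^ n)) j)).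
Proof.
rewrite /haar_indices big_cons; congr (_ + _).
rewrite big_allpairs_dep -(big_mkord xpredT (fun n =>
  \sum_(j < 2 ^ n) F (Some (Tagged (fun n => 'I_(2 ^ n)) j)))).
by rewrite /index_iota subn0; apply: eq_bigr => n _; rewrite big_enum.
Qed.

(** Adding the missing indices up to level [N] turns the left side into the sum
    of [sum_half_jump_le_maximal]. *)
Lemma sum_haar_coef_le N (S : seq (option dyadic)) a b :
  uniq S -> (forall I, I \in S -> (haar_level I <= N)%N) ->
  is_martingale N a -> is_martingale N b ->
  \sum_(I <- S) haar_mass I * (`|haar_coef a I| * `|haar_coef b I|) <=
  10 * level_mean N (fun k => running_max a N k * running_max b N k).
Proof.
move=> uS SN ma mb; apply: le_trans (sum_half_jump_le_maximal ma mb).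
pose T I := haar_mass I * (`|haar_coef a I| * `|haar_coef b I|).
rewrite -[leLHS]/(\sum_(I <- S) T I).
have <- : \sum_(I <- haar_indices N) T I = `|a 0 0| * `|b 0 0| + \sum_(n < N)
    level_mean n (fun k => `|half_jump a n k| * `|half_jump b n k|).
  rewrite sum_haar_indices {1}/T /haar_mass /= expr0 mul1r; congr (_ + _).
  by apply: eq_bigr => n _; rewrite /level_mean mulr_sumr.
have pe : perm_eq S [seq I <- haar_indices N | I \in S].
  apply: uniq_perm => [//||I]; first by rewrite filter_uniq// haar_indices_uniq.
  rewrite mem_filter; case IS : (I \in S) => //=.
  by rewrite mem_haar_indices// SN.
rewrite (perm_big _ pe) big_filter big_mkcond /=; apply: ler_sum => I _;
  case: ifP => // _.
by rewrite /T mulr_ge0 ?mulr_ge0// ltW// haar_mass_gt0.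
Qed.

(** The averages of a Haar function over intervals longer than the halves of its
    support vanish, since such an interval contains the support or misses it. *)
Definition haar_martingale J n k : R :=
  if (n < haar_level J)%N then 0 else haar_cell n J k.

Lemma haar_martingaleP N J : is_martingale N (haar_martingale J).
Proof.
move=> n k _; rewrite /haar_martingale.
case: J => [[m j]|] /=; last by lra.
move: (nat_of_ord j) => {}j.
have [nm|] := ltnP n m.+1; last first.
  move=> mn; rewrite !ifF; try by apply/negbTE; lia.
  rewrite (_ : (n.+1 - m.+1)%N = (n - m.+1).+1); last by lia.
  by rewrite !expnS !divnMA !divn2 doubleK /= uphalf_double; lra.
have [nm'|] := ltnP n.+1 m.+1; first by lra.
move=> mn; have -> : m = n by lia.
rewrite subnn expn0 !divn1 /haar_sign.
have -> : (k.*2 == j.*2.+1 :> nat) = false by apply/negbTE; lia.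
have -> : (k.*2.+1 == j.*2 :> nat) = false by apply/negbTE; lia.
by rewrite eqSS; case: (k.*2 == j.*2 :> nat) => /=; lra.
Qed.

Lemma haar_coef_haar_martingale I J : haar_coef (haar_martingale J) I = (I == J)%:R.
Proof.
rewrite /haar_martingale; case: I => [[n i]|]; case: J => [[m j]|] //=.
- rewrite /half_jump [(Some _ == _)](_ : _ = (n == m) && (i == j :> nat));
  last first.
    apply/eqP/andP => [[e]|[/eqP e /eqP ej]].
      by move: j; rewrite -e => j /eqP; rewrite eq_Tagged /= => /eqP->;
        rewrite !eqxx.
    by move: j ej; rewrite -e => j /val_inj ->.
  move: (nat_of_ord i) (nat_of_ord j) => {}i {}j.
  have [nm|mn] := ltnP n.+1 m.+1; first by rewrite (_ : (n == m) = false) ?subrr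
    ?mul0r//; apply/negbTE; lia.
  rewrite leq_eqVlt in mn; case/predU1P : mn => [[e]|mn].
    rewrite e eqxx subnn expn0 !divn1 /haar_sign !eqSS.
    have -> : (i.*2 == j.*2.+1 :> nat) = false by apply/negbTE; lia.
    have -> : (i.*2.+1 == j.*2 :> nat) = false by apply/negbTE; lia.
    have -> : (i.*2 == j.*2 :> nat) = (i == j :> nat) by rewrite -!mul2n eqn_pmul2l.
    by case: (i == j :> nat) => /=; lra.
  rewrite (_ : (n == m) = false); last by apply/negbTE; lia.
  rewrite (_ : (n.+1 - m.+1)%N = (n - m.+1).+1); last by lia.
  by rewrite !expnS !divnMA !divn2 doubleK /= uphalf_double subrr mul0r.
- by rewrite /half_jump subrr mul0r.
Qed.

Lemma haar_cell_orthogonal N I J : (haar_level I <= N)%N -> (haar_level J <= N)%N ->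
  level_mean N (fun k => haar_cell N I k * haar_cell N J k) =
  haar_mass I * (I == J)%:R.
Proof.
move=> IN JN; rewrite -haar_coef_haar_martingale.
rewrite -(@haar_cell_pairing N I _ (@haar_martingaleP N J) IN).
by apply: eq_level_mean => k _; rewrite /haar_martingale ltnNge JN.
Qed.

End HaarSums.

(** * Projections onto Haar functions are bounded by p q *)

Section Unconditionality.
Context {R : realType}.
Implicit Types (a b : nat -> nat -> R) (n k N : nat) (I : option dyadic).

(** Duality with g = sgn(w) |w|^(p-1), where w is the projection: the mean of
    |w|^p is the pairing of w with g, which [sum_haar_coef_le] bounds by the mean
    of the product of two maximal functions. Young's inequality with a weight,
    followed by Doob's inequality for p and for q, leaves the fraction 1/q of the
    mean of |w|^p on the right, which is absorbed. *)
Lemma haar_projection_bound (p q : R) N (S : seq (option dyadic)) a :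
  1 < p -> 0 < q -> p^-1 + q^-1 = 1 ->
  uniq S -> (forall I, I \in S -> (haar_level I <= N)%N) ->
  is_martingale N a ->
  level_mean N (fun k => `|\sum_(I <- S) haar_coef a I * haar_cell N I k| `^ p) <=
  (10 * p * q) `^ p * level_mean N (fun k => `|a N k| `^ p).
Proof.
move=> p1 q0 pq uS SN ma; have p0 : 0 < p by lra.
pose w k := \sum_(I <- S) haar_coef a I * haar_cell N I k.
pose g k := Num.sg (w k) * `|w k| `^ (p - 1).
pose b := martingale_of N g.
have mb : is_martingale N b := @martingale_ofP R N g.
have bN : b N = g := @martingale_of_top R N g.
have wg k : w k * g k = `|w k| `^ p.
  by rewrite /g mulrA -[w k * _]mulrC -normrEsg mulr_powRB1.
have pq1 := conjugate_mulB1 p0 q0 pq.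
have gq k : `|g k| `^ q <= `|w k| `^ p.
  rewrite -[X in _ <= _ `^ X]pq1 powRrM; apply: ge0_ler_powR;
    rewrite ?nnegrE ?powR_ge0 ?normr_ge0 ?(ltW q0)//.
  rewrite /g normrM normr_sg (ger0_norm (powR_ge0 _ _)).
  by case: eqP => _; rewrite ?mul0r ?mul1r ?powR_ge0.
set F := level_mean N (fun k => `|a N k| `^ p).
set Z := level_mean N _; rewrite -/F.
have Z0 : 0 <= Z by apply: level_mean_ge0 => k; exact: powR_ge0.
have F0 : 0 <= F by apply: level_mean_ge0 => k; exact: powR_ge0.
have q1 : 1 < q.
  have pV0 : 0 < p^-1 by rewrite invr_gt0.
  by rewrite -invf_lt1//; lra.
have Zle : Z <= 10 * level_mean N (fun k => running_max a N k * running_max b N k).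
  apply: le_trans (sum_haar_coef_le uS SN ma mb).
  have -> : Z = \sum_(I <- S) haar_coef a I * (haar_mass I * haar_coef b I).
    rewrite /Z -(@eq_level_mean _ N (fun k => w k * g k)); last by move=> k _;
      exact: wg.
    rewrite (@eq_level_mean _ N _ (fun k => \sum_(I <- S) haar_coef a I *
      (haar_cell N I k * b N k))); last first.
      by move=> k _; rewrite mulr_suml bN; apply: eq_bigr => I _; rewrite mulrA.
    rewrite level_mean_sum big_seq [RHS]big_seq; apply: eq_bigr => I IS.
    by rewrite level_meanZ haar_cell_pairing// SN.
  apply: ler_sum => I _; rewrite mulrCA ler_pM2l ?haar_mass_gt0//.
  by rewrite -normrM ler_norm.
(* the weight for which the last term below becomes exactly Z / q *)
pose la := 10 `^ (q^-1) * p.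
have la0 : 0 < la by rewrite mulr_gt0// powR_gt0.
have Young k : running_max a N k * running_max b N k <=
   (la `^ p / p) * running_max a N k `^ p + (10^-1 * p `^ (- q) / q) * running_max
     b N k `^ q.
  have A0 := running_max_ge0 a N k; have B0 := running_max_ge0 b N k.
  have h1 : 0 <= la * running_max a N k by rewrite mulr_ge0// ltW.
  have h2 : 0 <= la^-1 * running_max b N k by rewrite mulr_ge0// invr_ge0 ltW.
  have := conjugate_powR h1 h2 p0 q0 pq.
  rewrite mulrACA mulfV ?gt_eqF// mul1r (powRM _ (ltW la0) A0).
  rewrite (powRM _ _ B0) ?invr_ge0 ?(ltW la0)//.
  have -> : la^-1 `^ q = 10^-1 * p `^ (- q).
    rewrite -[la^-1]powR_inv1 ?ltW// -powRrM mulN1r powRN /la powRM ?powR_ge0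
      ?ltW//.
    by rewrite -powRrM mulrN mulVf ?gt_eqF// powR_inv1// !powRN.
  lra.
have {Zle}Zle : Z <= 10 * (la `^ p / p * (q `^ p * F) + 10^-1 * p `^ (- q) / q * (p
  `^ q * Z)).
  apply: le_trans Zle _; rewrite ler_pM2l//.
  apply: le_trans (ler_level_mean (fun k _ => Young k)) _.
  rewrite level_meanD !level_meanZ; apply: lerD; rewrite ler_wpM2l//.
  - by rewrite divr_ge0 ?powR_ge0 ?ltW.
  - exact: doob_maximal.
  - by rewrite divr_ge0 ?mulr_ge0 ?powR_ge0 ?ltW// invr_gt0.
  apply: le_trans (doob_maximal q1 p0 _ mb) _; first by rewrite addrC.
  rewrite ler_wpM2l ?powR_ge0//; apply: ler_level_mean => k _.
  by rewrite bN.
move: Zle.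
have -> : 10 * (la `^ p / p * (q `^ p * F) + 10^-1 * p `^ (- q) / q * (p `^ q * Z))
  =
   10 * (la `^ p * q `^ p * F) / p + Z / q.
  rewrite powRN; field; rewrite !gt_eqF// ?powR_gt0//.
have -> : q^-1 = 1 - p^-1 by lra.
move=> Zle.
have {Zle} : Z / p <= 10 * (la `^ p * q `^ p * F) / p by lra.
rewrite ler_pM2r ?invr_gt0// => Zle; apply: le_trans Zle _.
have p0' := ltW p0; have q0' := ltW q0.
clearbody F; rewrite !mulrA ler_wpM2r// /la (powRM _ (powR_ge0 _ _) p0') -powRrM.
rewrite (powRM _ _ q0') ?mulr_ge0// (powRM _ _ p0')//.
have -> : 10 `^ p = 10 * 10 `^ (q^-1 * p) :> R.
  rewrite -[X in X * _]powRr1// -powRD ?pnatr_eq0 ?implybT//; congr (_ `^ _).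
  have -> : q^-1 = 1 - p^-1 by lra.
  by field; rewrite gt_eqF.
by rewrite !mulrA.
Qed.

End Unconditionality.

(** * Sums of normalized Haar functions and the number of large coefficients *)

Section Democracy.
Context {R : realType}.
Implicit Types (a : nat -> nat -> R) (n k N L : nat) (I : option dyadic).

(** The exponents [l.-1] reflect that levels 0 and 1 both have the unit interval
    as support. *)
Lemma sum_geometric_le (r K : R) L : 1 < r -> r <= 2 -> 2 * r <= K * (r - 1) ->
  \sum_(l < L.+1) r ^+ l.-1 <= K * r ^+ L.-1.
Proof.
move=> r1 r2 rK.
have K2 : 2 <= K.
  rewrite -(ler_pM2r (_ : 0 < r - 1)); last by lra.
  by apply: le_trans rK; lra.
elim: L => [|[|L] IH]; first by rewrite big_ord1 /= expr0; lra.
  by rewrite big_ord_recr big_ord1 /= !expr0; lra.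
rewrite big_ord_recr /=; apply: (@le_trans _ _ (K * r ^+ L + r ^+ L.+1)).
  by rewrite lerD2r; exact: IH.
have rL : 0 <= r ^+ L by rewrite exprn_ge0//; lra.
rewrite exprS mulrA -mulrDl ler_wpM2r//; lra.
Qed.

(** Induction on the number of terms: if the last term is present, it dominates
    the whole sum up to the factor K by [sum_geometric_le]. *)
Lemma powR_sum_lacunary (r K p : R) L (t : nat -> bool) :
  0 < p -> 1 < r -> r <= 2 -> 2 * r <= K * (r - 1) ->
  (\sum_(l < L) (t l)%:R * r ^+ l.-1) `^ p <=
  K `^ p * \sum_(l < L) (t l)%:R * (r ^+ l.-1) `^ p.
Proof.
move=> p0 r1 r2 rK.
have K0 : 0 <= K.
  rewrite -(pmulr_lge0 _ (_ : 0 < r - 1)); last by lra.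
  by apply: le_trans rK; lra.
have rl l : 0 <= r ^+ l by rewrite exprn_ge0//; lra.
elim: L => [|L IH]; first by rewrite !big_ord0 powR0 ?mulr0 ?gt_eqF.
rewrite !big_ord_recr /=; case tL: (t L); last by rewrite !mul0r !addr0.
rewrite !mul1r; apply: (@le_trans _ _ ((K * r ^+ L.-1) `^ p)).
  apply: ge0_ler_powR; rewrite ?nnegrE ?mulr_ge0 ?(ltW p0)//.
    by rewrite addr_ge0// sumr_ge0// => i _; rewrite mulr_ge0.
  apply: le_trans (sum_geometric_le L r1 r2 rK); rewrite big_ord_recr /= lerD2r.
  by apply: ler_sum => i _; case: (t i); rewrite ?mul1r ?mul0r.
rewrite powRM// ler_wpM2l ?powR_ge0// lerDr sumr_ge0// => i _.
by rewrite mulr_ge0 ?powR_ge0.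
Qed.

(** A sum of distinct powers of 2 is at most twice its largest term, the two
    terms equal to 1 included. *)
Lemma sum_pow2_le_max (X : R) L (t : nat -> bool) : 0 <= X ->
  (forall l, (l < L)%N -> t l -> 2 ^+ l.-1 <= X) ->
  \sum_(l < L) (t l)%:R * 2 ^+ l.-1 <= 2 * X.
Proof.
move=> X0; elim: L => [|L IH] h; first by rewrite big_ord0 mulr_ge0.
case tL: (t L); last first.
  by rewrite big_ord_recr /= tL mul0r addr0 IH// => l lL; apply: h; exact: ltnW.
apply: (@le_trans _ _ (2 * 2 ^+ L.-1)); last by rewrite ler_pM2l//; apply: h tL.
have -> : 2 * 2 ^+ L.-1 = 2 ^+ L.-1.+1 :> R by rewrite exprS.
apply: (@le_trans _ _ (\sum_(l < L.+1) (2 ^+ l.-1 : R))).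
  by apply: ler_sum => i _; case: (t i); rewrite ?mul1r ?mul0r// exprn_ge0.
clear; elim: L => [|[|L] IH]; first by rewrite big_ord1 /= expr0 expr1; lra.
  by rewrite big_ord_recr big_ord1 /= !expr0 expr1; lra.
rewrite big_ord_recr /=; apply: le_trans (lerD IH (lexx _)) _.
by rewrite /= [X in _ <= X]exprS; lra.
Qed.

(** At most one Haar function of each level is nonzero on a given interval, so a
    sum over [A] of level-dependent weights is governed by the set [t] of levels
    that occur. *)
Lemma sum_haar_by_level N (A : seq (option dyadic)) k :
  uniq A -> (forall I, I \in A -> (haar_level I <= N)%N) -> (k < 2 ^ N)%N ->
  exists t : nat -> bool,
    (forall v : nat -> R, \sum_(I <- A) v (haar_level I) * `|haar_cell N I k| =
       \sum_(l < N.+1) (t l)%:R * v l) /\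
    (forall l, t l -> exists2 I, I \in A &
       haar_level I = l /\ (haar_pos I = k %/ 2 ^ (N - l.-1))%N).
Proof.
move=> uA AN kN.
pose hit l I := (haar_level I == l) && (haar_pos I == k %/ 2 ^ (N - l.-1))%N.
exists (fun l => has (hit l) A); split; last first.
  by move=> l /hasP[I IA /andP[/eqP e1 /eqP e2]]; exists I.
move=> v.
have cnt l : (has (hit l) A)%:R = \sum_(I <- A) (hit l I)%:R :> R.
  transitivity ((count (hit l) A)%:R : R); last first.
    by rewrite -sum1_count natr_sum big_mkcond /=; apply: eq_bigr => I _;
      case: (hit l I).
  congr (_%:R); rewrite has_count.
  have : (count (hit l) A <= 1)%N.
    rewrite -size_filter; have : uniq ([seq I <- A | hit l I]) by rewrite
      filter_uniq.
    have : forall I, I \in [seq I <- A | hit l I] -> hit l I by move=> I;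
      rewrite mem_filter => /andP[].
    case: [seq _ <- A | _] => [|I [|I' s]]//= h; rewrite !inE negb_or =>
      /andP[/andP[ne _] _].
    have /andP[/eqP e1 /eqP e2] := h I (mem_head _ _).
    have /andP[/eqP e3 /eqP e4] : hit l I' by apply: h; rewrite !inE eqxx orbT.
    by case/eqP: ne; apply: haar_level_pos_inj; rewrite ?e1 ?e2.
  by case: count => [|[|]].
under [RHS]eq_bigr do rewrite cnt mulr_suml.
rewrite exchange_big /= big_seq [RHS]big_seq; apply: eq_bigr => I IA.
have IN := AN I IA; rewrite norm_haar_cell// mulrC.
have lt : (haar_level I < N.+1)%N by [].
rewrite (bigD1 (Ordinal lt)) //= big1 ?addr0.
  by rewrite /hit eqxx eq_sym.
by move=> i; rewrite -val_eqE /= eq_sym /hit => /negbTE->; rewrite mul0r.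
Qed.

(** The p-th power of each normalized Haar function has integral 1, so the integral
    of the sum of these powers counts the set. *)
Lemma sum_mass_haar N (A : seq (option dyadic)) :
  (forall I, I \in A -> (haar_level I <= N)%N) ->
  level_mean N (fun k => \sum_(I <- A) 2 ^+ (haar_level I).-1 * `|haar_cell N I k|)
  = (size A)%:R :> R.
Proof.
move=> AN; rewrite level_mean_sum big_seq.
rewrite (eq_bigr (fun=> 1)); last first.
  move=> I IA; rewrite level_meanZ level_mean_norm_haar ?AN// /haar_mass.
  by rewrite -exprMn mulfV ?expr1n// pnatr_eq0.
by rewrite -big_seq big_const_seq count_predT iter_addr_0.
Qed.

(** [r] stands for 2^(1/p), so that [r ^+ (haar_level I).-1] is the modulus of the
    normalized Haar function. Pointwise [powR_sum_lacunary], then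
    [sum_mass_haar]. *)
Lemma haar_sum_upper (p r K tau : R) N (A : seq (option dyadic))
    (c : option dyadic -> R) :
  0 < p -> 1 < r -> r <= 2 -> r `^ p = 2 -> 2 * r <= K * (r - 1) ->
  uniq A -> (forall I, I \in A -> (haar_level I <= N)%N) ->
  0 <= tau -> (forall I, I \in A -> `|c I| <= tau) ->
  level_mean N (fun k =>
    `|\sum_(I <- A) c I * (r ^+ (haar_level I).-1 * haar_cell N I k)| `^ p) <=
  (tau * K) `^ p * (size A)%:R.
Proof.
move=> p0 r1 r2 rp rK uA AN tau0 ctau.
have K0 : 0 <= K.
  rewrite -(pmulr_lge0 _ (_ : 0 < r - 1)); last by lra.
  by apply: le_trans rK; lra.
rewrite -(sum_mass_haar AN) -level_meanZ; apply: ler_level_mean => k kN.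
have [t [ht _]] := sum_haar_by_level uA AN kN.
have r0 l : 0 <= r ^+ l by rewrite exprn_ge0//; lra.
rewrite (ht (fun l => 2 ^+ l.-1)).
apply: (@le_trans _ _ ((tau * \sum_(l < N.+1) (t l)%:R * r ^+ l.-1) `^ p)).
  apply: ge0_ler_powR; rewrite ?nnegrE ?normr_ge0 ?(ltW p0)//.
    by rewrite mulr_ge0// sumr_ge0// => i _; rewrite mulr_ge0.
  rewrite -(ht (fun l => r ^+ l.-1)) mulr_sumr; apply: le_trans (ler_norm_sum _ _
    _) _.
  rewrite big_seq [leRHS]big_seq; apply: ler_sum => I IA.
  by rewrite !normrM (ger0_norm (r0 _)) ler_wpM2r ?mulr_ge0// ctau.
rewrite powRM// ?sumr_ge0// => [|i _]; last by rewrite mulr_ge0.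
rewrite (powRM _ tau0 K0) -mulrA ler_wpM2l ?powR_ge0//.
apply: le_trans (powR_sum_lacunary _ _ p0 r1 r2 rK) _.
rewrite ler_wpM2l ?powR_ge0//; apply: ler_sum => i _.
rewrite -[r ^+ _]powR_mulrn; last by lra.
by rewrite powRAC rp powR_mulrn.
Qed.

(** Pointwise, the sum of |I|^-1 over the intervals of [B] that contain the point is
    at most twice its largest term, hence at most twice the p-th power of the
    maximal function divided by tau; integrate and apply Doob's inequality. *)
Lemma size_le_maximal (p q r tau : R) N (B : seq (option dyadic)) a :
  1 < p -> 0 < q -> p^-1 + q^-1 = 1 ->
  1 < r -> r `^ p = 2 ->
  uniq B -> (forall I, I \in B -> (haar_level I <= N)%N) ->
  is_martingale N a ->
  0 <= tau ->
  (forall I, I \in B ->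
    tau * r ^+ (haar_level I).-1 <= `|a (haar_level I).-1 (haar_pos I)|) ->
  tau `^ p * (size B)%:R <= 2 * q `^ p * level_mean N (fun k => `|a N k| `^ p).
Proof.
move=> p1 q0 pq r1 rp uB BN ma tau0 hB; have p0 : 0 < p by lra.
rewrite -mulrA; apply: (@le_trans _ _ (2 * level_mean N (fun k =>
  running_max a N k `^ p))); last first.
  by rewrite ler_wpM2l//; exact: doob_maximal.
rewrite -(sum_mass_haar BN) -!level_meanZ; apply: ler_level_mean => k kN.
have [t [ht hex]] := sum_haar_by_level uB BN kN.
rewrite (ht (fun l => 2 ^+ l.-1)).
move: tau0; rewrite le_eqVlt => /predU1P[<-|tau0].
  by rewrite powR0 ?gt_eqF// mul0r mulr_ge0// powR_ge0.
have tp0 : 0 < tau `^ p by rewrite powR_gt0.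
rewrite -ler_pdivlMl// mulrCA; apply: sum_pow2_le_max.
  by rewrite mulr_ge0 ?powR_ge0// invr_ge0 ltW.
move=> l lN /hex[I IB [e1 e2]]; rewrite ler_pdivlMl//.
have -> : 2 ^+ l.-1 = (r ^+ l.-1) `^ p.
  by rewrite -(powR_mulrn l.-1 (ltW (lt_trans ltr01 r1))) powRAC rp powR_mulrn.
have rl0 : 0 <= r ^+ l.-1 by rewrite exprn_ge0//; lra.
rewrite -powRM ?(ltW tau0)//; apply: ge0_ler_powR;
  rewrite ?nnegrE ?running_max_ge0 ?(ltW p0)//.
  by rewrite mulr_ge0// ltW.
have := hB I IB; rewrite e1 e2 => /le_trans; apply.
apply: le_trans (running_max_ge _ _ _) _; apply: running_max_ancestor.
by rewrite -e1; apply: leq_trans (BN I IB); exact: leq_pred.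
Qed.

End Democracy.

(** * Step functions and averages on the unit interval *)

Section UnitInterval.
Context {R : realType}.
Local Notation mu := (lebesgue01 R).
Local Notation T := (measurableTypeR R).
Implicit Types (u v : T -> R) (n k N : nat) (x : R).

Definition dyadic_cell n k : set T := `[k%:R / 2 ^+ n, k.+1%:R / 2 ^+ n[.

Lemma measurable_dyadic_cell n k : measurable (dyadic_cell n k).
Proof. exact: measurable_itv. Qed.
Hint Resolve measurable_dyadic_cell : core.

Lemma in_dyadic_cell n k x : 0 <= x ->
  (x \in dyadic_cell n k) = (Num.truncn (2 ^+ n * x) == k).
Proof.
move=> x0; have p : 0 < 2 ^+ n :> R by rewrite exprn_gt0.
rewrite truncn_eq ?mulr_ge0 ?(ltW p)//; apply/idP/idP.
  rewrite inE /dyadic_cell /= in_itv /= => /andP[h1 h2].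
  by rewrite mulrC -ler_pdivrMr// h1 -ltr_pdivlMr.
move=> /andP[h1 h2]; rewrite inE /dyadic_cell /= in_itv /=.
by rewrite ler_pdivrMr// ltr_pdivlMr// mulrC h1.
Qed.

Lemma notin_dyadic_cell n k x : (k < 2 ^ n)%N -> ~~ (0 <= x < 1) ->
  x \in dyadic_cell n k = false.
Proof.
move=> kn; apply: contraNF; have p : 0 < 2 ^+ n :> R by rewrite exprn_gt0.
rewrite inE /dyadic_cell /= in_itv /= => /andP[h1 h2]; apply/andP; split.
  by apply: le_trans h1; rewrite divr_ge0// ltW.
apply: lt_le_trans h2 _; rewrite ler_pdivrMr// mul1r.
by rewrite -natrX ler_nat.
Qed.

(** Numbering of nested dyadic intervals: [Num.truncn (2 ^+ n * x)] is the
    interval of level [n] that contains [x]. *)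
Lemma truncn_divn N n x : (n <= N)%N -> 0 <= x ->
  (Num.truncn (2 ^+ N * x) %/ 2 ^ (N - n))%N = Num.truncn (2 ^+ n * x).
Proof.
move=> nN x0; set i := (N - n)%N.
have -> : 2 ^+ N * x = 2 ^+ i * (2 ^+ n * x).
  by rewrite mulrA -exprD subnK.
have y0 : 0 <= 2 ^+ n * x by rewrite mulr_ge0// exprn_ge0.
move: (2 ^+ n * x) y0 => y y0.
have p : 0 < 2 ^+ i :> R by rewrite exprn_gt0.
have /andP[h1 h2] := truncn_itv y0.
have h3 : (Num.truncn y * 2 ^ i <= Num.truncn (2 ^+ i * y))%N.
  rewrite truncn_ge_nat; last by rewrite mulr_ge0// ltW.
  by rewrite natrM natrX mulrC ler_pM2l.
have h4 : (Num.truncn (2 ^+ i * y) < (Num.truncn y).+1 * 2 ^ i)%N.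
  rewrite truncn_lt_nat; last by rewrite mulr_ge0// ltW.
  by rewrite natrM natrX mulrC ltr_pM2r.
apply/eqP; rewrite eqn_leq; apply/andP; split.
  by rewrite -ltnS ltn_divLR// expn_gt0.
by rewrite leq_divRL// expn_gt0.
Qed.

Lemma truncn_lt_pow2 N x : 0 <= x < 1 -> (Num.truncn (2 ^+ N * x) < 2 ^ N)%N.
Proof.
move=> /andP[x0 x1]; have p : 0 < 2 ^+ N :> R by rewrite exprn_gt0.
rewrite truncn_lt_nat; last by rewrite mulr_ge0// ltW.
by rewrite natrX -[ltRHS]mulr1 ltr_pM2l.
Qed.

(** Zero outside the unit interval, as the Haar functions are. *)
Definition step N (F : nat -> R) : T -> R :=
  fun x => \sum_(k < 2 ^ N) F k * \1_(dyadic_cell N k) x.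

Lemma step_in N F x : 0 <= x < 1 -> step N F x = F (Num.truncn (2 ^+ N * x)).
Proof.
move=> x01; have /andP[x0 _] := x01.
rewrite /step (bigD1 (Ordinal (truncn_lt_pow2 N x01))) //= big1 ?addr0.
  by rewrite indicE in_dyadic_cell// eqxx mulr1.
move=> i; rewrite -val_eqE /= indicE in_dyadic_cell// eq_sym => /negbTE->.
by rewrite mulr0.
Qed.

Lemma step_out N F x : ~~ (0 <= x < 1) -> step N F x = 0.
Proof.
move=> x01; rewrite /step big1// => i _.
by rewrite indicE notin_dyadic_cell// mulr0.
Qed.

Lemma step_comp (phi : R -> R) N F x : phi 0 = 0 ->
  phi (step N F x) = step N (fun k => phi (F k)) x.
Proof.
move=> phi0; case: (boolP (0 <= x < 1)) => x01; first by rewrite !step_in.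
by rewrite !step_out.
Qed.

Lemma stepM N F G x : step N F x * step N G x = step N (fun k => F k * G k) x.
Proof.
case: (boolP (0 <= x < 1)) => x01; first by rewrite !step_in.
by rewrite !step_out// mul0r.
Qed.

Lemma stepZ N c F x : c * step N F x = step N (fun k => c * F k) x.
Proof. by rewrite /step mulr_sumr; apply: eq_bigr => i _; rewrite mulrA. Qed.

Lemma step_sum (I : Type) (s : seq I) N (F : I -> nat -> R) x :
  \sum_(i <- s) step N (F i) x = step N (fun k => \sum_(i <- s) F i k) x.
Proof.
by rewrite /step exchange_big; apply: eq_bigr => k _; rewrite mulr_suml.
Qed.

Lemma measurable_step N F : measurable_fun setT (step N F).
Proof.
apply: measurable_sum => k; apply: measurable_funM; first exact: measurable_cst.
exact: measurable_indic.
Qed.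

Lemma measure_dyadic_cell n k : (k < 2 ^ n)%N ->
  mu (dyadic_cell n k) = (2^-1 ^+ n)%:E.
Proof.
move=> kn; rewrite /lebesgue01 /= /mrestr setIidl; last first.
  move=> x /mem_set; apply: contraTP => x01.
  rewrite notin_dyadic_cell//; apply/negP => h; apply: x01.
  by rewrite /= in_itv.
have p : 0 < 2 ^+ n :> R by rewrite exprn_gt0.
rewrite lebesgue_measure_itv /= lte_fin ltr_pM2r ?invr_gt0// ltr_nat ltnSn.
by rewrite -EFinB -mulrBl -natrB// subSnn mul1r exprVn.
Qed.

Lemma lebesgue01_setT : mu setT = 1%E.
Proof.
rewrite /lebesgue01 /= /mrestr setTI lebesgue_measure_itv /= lte_fin ltr01.
by rewrite oppr0 adde0.
Qed.

Lemma lebesgue01_outside : mu (~` dyadic_cell 0 0) = 0%E.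
Proof.
rewrite /lebesgue01 /= /mrestr (_ : _ `&` _ = set0) ?measure0//.
apply/seteqP; split => x //= [h]; rewrite in_itv /= => x01; apply: h.
by rewrite /dyadic_cell /= in_itv /= expr0 !divr1.
Qed.

Local Notation intg u := (mu.-integrable setT (EFin \o u)).

Lemma intg_measurable u : intg u -> measurable_fun setT u.
Proof. by move=> /measurable_int/measurable_EFinP. Qed.

Lemma intg_dominated u v : measurable_fun setT u -> (forall x, `|u x| <= `|v x|) ->
  intg v -> intg u.
Proof.
move=> meas_u uv; apply: le_integrable => //; first exact/measurable_EFinP.
by move=> x _; rewrite /= lee_fin.
Qed.

Lemma intg_cst c : intg (fun=> c).
Proof.
apply/integrableP; split; first exact/measurable_EFinP.
by rewrite integral_cst// lebesgue01_setT mule1 ltey.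
Qed.

Lemma intgD u v : intg u -> intg v -> intg (fun x => u x + v x).
Proof. by move=> h1 h2; have := integrableD measurableT h1 h2. Qed.

Lemma intgZ c u : intg u -> intg (fun x => c * u x).
Proof. by move=> h; have := integrableZl measurableT c h. Qed.

Lemma intgM_step u N F : intg u -> intg (fun x => u x * step N F x).
Proof.
move=> iu; pose C := \sum_(k < 2 ^ N) `|F k|.
apply: (@intg_dominated _ (fun x => C * u x)); last exact: intgZ.
  by apply: measurable_funM; [exact: intg_measurable|exact: measurable_step].
move=> x; rewrite !normrM mulrC ler_wpM2r//.
have C0 : 0 <= C by apply: sumr_ge0.
rewrite (ger0_norm C0); apply: le_trans (ler_norm_sum _ _ _) _.
apply: ler_sum => k _; rewrite normrM indicE.
by case: (_ \in _); rewrite ?normr1 ?normr0 ?mulr1 ?mulr0.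
Qed.

Lemma intg_step N F : intg (step N F).
Proof.
have := intgM_step N F (intg_cst 1); apply: eq_integrable => // x _.
by rewrite /= mul1r.
Qed.

Lemma intgM_cell u n k : intg u -> intg (fun x => u x * \1_(dyadic_cell n k) x).
Proof.
move=> iu; apply: (@intg_dominated _ u) => //.
  by apply: measurable_funM; [exact: intg_measurable|exact: measurable_indic].
move=> x; rewrite normrM ler_piMr// indicE.
by case: (_ \in _); rewrite ?normr1 ?normr0.
Qed.

Definition Rint u : R := Rintegral mu setT u.

Lemma RintD u v : intg u -> intg v -> Rint (fun x => u x + v x) = Rint u + Rint v.
Proof. by move=> iu iv; rewrite /Rint RintegralD. Qed.

Lemma RintZ c u : intg u -> Rint (fun x => c * u x) = c * Rint u.
Proof. by move=> iu; rewrite /Rint RintegralZl. Qed.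

Lemma eq_Rint u v : (forall x, u x = v x) -> Rint u = Rint v.
Proof. by move=> h; congr Rint; apply/funext. Qed.

Lemma Rint_sum (I : Type) (s : seq I) (u : I -> T -> R) : (forall i, intg (u i)) ->
  intg (fun x => \sum_(i <- s) u i x) /\
  Rint (fun x => \sum_(i <- s) u i x) = \sum_(i <- s) Rint (u i).
Proof.
move=> iu; elim: s => [|i s [IH1 IH2]].
  rewrite big_nil (_ : (fun _ => _) = (fun=> 0)); last by apply/funext => x;
    rewrite big_nil.
  by split; [exact: intg_cst|rewrite /Rint Rintegral_cst// mul0r].
rewrite (_ : (fun _ => _) = (fun x => u i x + \sum_(j <- s) u j x)); last first.
  by apply/funext => x; rewrite big_cons.
by rewrite big_cons RintD// IH2; split => //; apply: intgD.
Qed.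

Lemma le_Rint u v : intg u -> intg v -> (forall x, u x <= v x) -> Rint u <= Rint v.
Proof. by move=> iu iv uv; apply: le_Rintegral. Qed.

Lemma ler_norm_Rint u : intg u -> `|Rint u| <= Rint (fun x => `|u x|).
Proof. by move=> iu; apply: le_normr_Rintegral. Qed.

Lemma Rint_cell n k : (k < 2 ^ n)%N -> Rint (\1_(dyadic_cell n k)) = 2^-1 ^+ n.
Proof.
move=> kn; rewrite /Rint /Rintegral integral_indic// setIT.
by rewrite measure_dyadic_cell.
Qed.

Definition dyadic_avg u n k : R := 2 ^+ n * Rint (fun x =>
  u x * \1_(dyadic_cell n k) x).

Lemma cell_split n k x : \1_(dyadic_cell n k) x =
  \1_(dyadic_cell n.+1 k.*2) x + \1_(dyadic_cell n.+1 k.*2.+1) x :> R.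
Proof.
case: (leP 0 x) => x0.
  rewrite !indicE !in_dyadic_cell//.
  have := truncn_divn (leqnSn n) x0; rewrite subSnn expn1 divn2 => <-.
  set m := Num.truncn _; rewrite -[m in RHS]odd_double_half.
  have e0 (i : nat) : (i.*2 == k.*2) = (i == k) by rewrite -!mul2n eqn_pmul2l.
  case: (odd m); rewrite ?add0n ?add1n ?eqSS e0.
    have -> : (m./2.*2.+1 == k.*2) = false by apply/negbTE; lia.
    by rewrite add0r.
  have -> : (m./2.*2 == k.*2.+1) = false by apply/negbTE; lia.
  by rewrite addr0.
rewrite !indicE.
have out m j : x \in dyadic_cell m j = false.
  apply/negP; rewrite inE /dyadic_cell /= in_itv /= => /andP[h _].
  suff : 0 <= x by rewrite leNgt x0.
  by apply: le_trans h; rewrite divr_ge0// exprn_ge0.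
by rewrite !out addr0.
Qed.

Lemma dyadic_avg_martingale u N : intg u -> is_martingale N (dyadic_avg u).
Proof.
move=> iu n k _; rewrite /dyadic_avg.
rewrite (@eq_Rint _ (fun x => u x * \1_(dyadic_cell n.+1 k.*2) x +
                              u x * \1_(dyadic_cell n.+1 k.*2.+1) x)).
  by rewrite RintD; try exact: intgM_cell; rewrite exprS; field.
by move=> x; rewrite -mulrDr -cell_split.
Qed.

(** Integration against a function of level [N] only sees the averages of level
    [N]: this is the passage from functions to martingales. *)
Lemma Rint_mul_step u N F : intg u ->
  Rint (fun x => u x * step N F x) = level_mean N (fun k => F k * dyadic_avg u N k).
Proof.
move=> iu.
rewrite (_ : (fun x => _) = (fun x => \sum_(k < 2 ^ N) F k * (u x * \1_(dyadic_cell
  N k) x))); last first.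
  by apply/funext => x; rewrite /step mulr_sumr; apply: eq_bigr => k _;
    rewrite mulrCA.
have [|_ ->] := @Rint_sum _ (index_enum 'I_(2 ^ N)) (fun (k : 'I_(2 ^ N)) x =>
  F k * (u x * \1_(dyadic_cell N k) x)).
  by move=> k; apply: intgZ; exact: intgM_cell.
rewrite /level_mean mulr_sumr; apply: eq_bigr => k _.
rewrite RintZ; last exact: intgM_cell.
by rewrite /dyadic_avg [RHS]mulrCA (mulrA (2^-1 ^+ N)) -exprMn mulVf ?pnatr_eq0//
  expr1n mul1r.
Qed.

Lemma dyadic_avg_cst n k : (k < 2 ^ n)%N -> dyadic_avg (fun=> 1) n k = 1.
Proof.
move=> kn; rewrite /dyadic_avg (@eq_Rint _ \1_(dyadic_cell n k)).
  by rewrite Rint_cell// -exprMn mulfV ?pnatr_eq0// expr1n.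
by move=> x; rewrite mul1r.
Qed.

Lemma Rint_step N F : Rint (step N F) = level_mean N F.
Proof.
rewrite -(@eq_Rint (fun x => 1 * step N F x)); last by move=> x; rewrite mul1r.
rewrite Rint_mul_step; last exact: intg_cst.
by apply: eq_level_mean => k kN; rewrite dyadic_avg_cst// mulr1.
Qed.

Lemma integral_EFin_Rint u : intg u -> (\int[mu]_x (u x)%:E)%E = (Rint u)%:E.
Proof. by move=> iu; rewrite /Rint /Rintegral fineK//;
  exact: integrable_fin_num. Qed.

Lemma Rint_avg0 u : intg u -> Rint u = dyadic_avg u 0 0.
Proof.
move=> iu; rewrite /dyadic_avg expr0 mul1r /Rint /Rintegral; congr fine.
rewrite (negligible_integral (measurableC (measurable_dyadic_cell 0 0)) _ iu)//;
  last exact: lebesgue01_outside.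
rewrite [RHS](negligible_integral (measurableC (measurable_dyadic_cell 0 0)))//;
  last 2 first.
- exact: intgM_cell.
- exact: lebesgue01_outside.
by apply: eq_integral => x; rewrite inE => -[_ /= /contrapT h];
  rewrite indicE mem_set// mulr1.
Qed.

Lemma jensen_avg (p : R) u N : 1 < p -> intg u -> intg (fun x => `|u x| `^ p) ->
  level_mean N (fun k => `|dyadic_avg u N k| `^ p) <= Rint (fun x => `|u x| `^ p).
Proof.
move=> p1 iu iup; set v := fun x => `|u x| `^ p.
have p0 : 0 < p by lra.
have -> : Rint v = level_mean N (dyadic_avg v N).
  rewrite (level_mean_martingale (@dyadic_avg_martingale v N iup) (leq0n N)).
  by rewrite level_mean0; exact: Rint_avg0.
apply: ler_level_mean => k kN.
set A := `|dyadic_avg u N k|.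
have A0 : 0 <= A := normr_ge0 _.
have pN : 0 < 2 ^+ N :> R by rewrite exprn_gt0.
set c := \1_(dyadic_cell N k) : T -> R.
have c01 x : (c x = 0) \/ (c x = 1).
  by rewrite /c indicE; case: (_ \in _); [right|left].
(* t^p lies above its tangent line at A, the modulus of the average; after
   integration over the interval the linear term is nonnegative. *)
have tangent x : A `^ p * c x + (p * A `^ (p - 1)) * (`|u x * c x| - A * c x) <= v
  x * c x.
  case: (c01 x) => ->; first by rewrite !mulr0 normr0 subr0 mulr0 addr0.
  rewrite !mulr1 /v; set t := `|u x|.
  pose q := p / (p - 1).
  have q0 : 0 < q by rewrite divr_gt0//; lra.
  have pq : p^-1 + q^-1 = 1 by rewrite /q invf_div; field; rewrite gt_eqF.
  have := conjugate_powR (powR_ge0 A (p - 1)) (normr_ge0 (u x)) q0 p0.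
  rewrite addrC => /(_ pq); rewrite -powRrM conjugate_mulB1// -/t => h.
  have e : A `^ (p - 1) * A = A `^ p by rewrite mulrC mulr_powRB1.
  rewrite mulrBr -mulrA -[in X in _ - X]mulrA e.
  have -> : t `^ p = p * (t `^ p / p) by field; rewrite gt_eqF.
  have h2 : p * (A `^ (p - 1) * t) <= p * (A `^ p / q + t `^ p / p) by rewrite
    ler_pM2l.
  have h3 : p / q = p - 1.
    have -> : q^-1 = 1 - p^-1 by lra.
    by field; rewrite gt_eqF.
  have h4 : p * (A `^ p / q) = (p - 1) * A `^ p by rewrite -h3; ring.
  rewrite mulrDr h4 in h2; lra.
have ic : intg c by apply: (intg_dominated _ _ (intg_cst 1)) => [|x];
  [exact: measurable_indic|case: (c01 x) => ->; rewrite ?normr0 ?normr1].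
have iuc : intg (fun x => u x * c x) := intgM_cell _ _ iu.
have iauc : intg (fun x => `|u x * c x|) by exact: integrable_norm.
have ivc : intg (fun x => v x * c x) := intgM_cell _ _ iup.
have i1 : intg (fun x => A `^ p * c x) by exact: intgZ.
have i2' : intg (fun x => - A * c x) by exact: intgZ.
have i2 : intg (fun x => `|u x * c x| - A * c x).
  rewrite (_ : (fun x => _) = (fun x => `|u x * c x| + - A * c x));
    last by apply/funext => x; rewrite mulNr.
  exact: intgD.
have i3 : intg (fun x => (p * A `^ (p - 1)) * (`|u x * c x| - A * c x)) by exact:
  intgZ.
have := le_Rint (intgD i1 i3) ivc tangent.
rewrite RintD// !RintZ//.
rewrite (@eq_Rint (fun x => `|u x * c x| - A * c x) (fun x =>
  `|u x * c x| + - A * c x)); last by move=> x; rewrite mulNr.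
rewrite RintD// RintZ// Rint_cell//.
have h5 := ler_norm_Rint iuc.
have h6 : `|Rint (fun x => u x * c x)| = A * 2^-1 ^+ N.
  rewrite /A /dyadic_avg normrM (ger0_norm (ltW pN)) mulrAC -exprMn mulfV
    ?pnatr_eq0//.
  by rewrite expr1n mul1r.
rewrite h6 in h5.
have h7 : 0 <= p * A `^ (p - 1) * (Rint (fun x => `|u x * c x|) + - A * 2^-1 ^+ N).
  by apply: mulr_ge0; [rewrite mulr_ge0 ?powR_ge0// ltW|lra].
move=> h8; rewrite /dyadic_avg -/c.
have h9 : A `^ p * 2^-1 ^+ N <= Rint (fun x => v x * c x) by lra.
have := h9; rewrite -(ler_pM2l pN) mulrCA -exprMn mulfV ?pnatr_eq0// expr1n mulr1.
by [].
Qed.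

End UnitInterval.

(** * Norms of real functions and the Haar system as step functions *)

Section RealNorm.
Context {R : realType}.
Local Notation mu := (lebesgue01 R).
Local Notation T := (measurableTypeR R).
Local Notation intg u := (mu.-integrable setT (EFin \o u)).
Implicit Types (u v : T -> R) (p q : R).

Definition Lnorm01 p u : \bar R := Lnorm mu p%:E (fun x => (u x)%:E).

Lemma integral_powR p u :
  (\int[mu]_x (`|(u x)%:E| `^ p) = \int[mu]_x (`|u x| `^ p)%:E)%E.
Proof. by []. Qed.

Lemma measurable_powR_norm p u : measurable_fun setT u ->
  measurable_fun setT (fun x => `|u x| `^ p).
Proof.
move=> meas_u; apply: (@measurableT_comp _ _ _ _ _ _ (@powR R ^~ p)) => //.
exact: measurableT_comp.
Qed.

(** On a space of measure 1 the modulus is dominated by 1 + |u|^p. *)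
Lemma Lnorm01_fin_integrable p u : 1 < p -> measurable_fun setT u ->
  (Lnorm01 p u < +oo)%E -> intg (fun x => `|u x| `^ p) /\ intg u.
Proof.
move=> p1 meas_u fin; have p0 : p != 0 by rewrite gt_eqF//; lra.
have ip : intg (fun x => `|u x| `^ p).
  apply/integrableP; split; first by apply/measurable_EFinP;
    exact: measurable_powR_norm.
  have := powR_Lnorm mu (fun x => (u x)%:E) p0; rewrite integral_powR.
  move=> e; rewrite (eq_integral (fun x => (`|u x| `^ p)%:E)).
    by rewrite -e; exact: poweR_lty.
  by move=> x _; rewrite /= ger0_norm ?powR_ge0.
split => //; apply: (@intg_dominated _ _ (fun x => 1 + `|u x| `^ p)) => //.
  move=> x; have h := powR_ge0 `|u x| p.
  rewrite [X in _ <= X]ger0_norm; last by lra.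
  have [h1|h1] := leP `|u x| 1; first by lra.
  by have := le1r_powR (ltW h1) (ltW p1); lra.
by apply: intgD => //; exact: intg_cst.
Qed.

Lemma Lnorm01E p u : intg (fun x => `|u x| `^ p) ->
  Lnorm01 p u = ((Rint (fun x => `|u x| `^ p)) `^ (p^-1))%:E.
Proof.
move=> iu; rewrite /Lnorm01 unlock /= integral_powR.
by rewrite (integral_EFin_Rint iu) poweR_EFin.
Qed.

Lemma Lnorm01_le_scaled p C u v : 1 < p -> 0 <= C ->
  intg (fun x => `|u x| `^ p) -> intg (fun x => `|v x| `^ p) ->
  Rint (fun x => `|u x| `^ p) <= C `^ p * Rint (fun x => `|v x| `^ p) ->
  (Lnorm01 p u <= C%:E * Lnorm01 p v)%E.
Proof.
move=> p1 C0 iu iv h; have p0 : 0 < p by lra.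
rewrite !Lnorm01E// -EFinM lee_fin.
have R0 w : 0 <= Rint (fun x => `|w x| `^ p) by apply: Rintegral_ge0 => x _;
  exact: powR_ge0.
have -> : C = (C `^ p) `^ p^-1 by rewrite -powRrM mulfV ?powRr1// gt_eqF.
rewrite -powRM ?powR_ge0//; apply: ge0_ler_powR => //.
- by rewrite invr_ge0 ltW.
- by rewrite nnegrE.
- by rewrite nnegrE mulr_ge0 ?powR_ge0.
Qed.

Lemma Lnorm01_mono p u v : 1 < p -> measurable_fun setT u ->
  measurable_fun setT v ->
  (forall x, `|u x| <= `|v x|) -> (Lnorm01 p u <= Lnorm01 p v)%E.
Proof.
move=> p1 meas_u mv uv; have p0 : 0 < p by lra.
rewrite /Lnorm01 unlock /= !integral_powR.
apply: gt0_ler_poweR; first by rewrite invr_ge0 ltW.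
- by rewrite in_itv /= leey andbT integral_ge0// => x _; rewrite lee_fin powR_ge0.
- by rewrite in_itv /= leey andbT integral_ge0// => x _; rewrite lee_fin powR_ge0.
apply: ge0_le_integral => //.
- by apply/measurable_EFinP; exact: measurable_powR_norm.
- by apply/measurable_EFinP; exact: measurable_powR_norm.
by move=> x _; rewrite lee_fin; apply: ge0_ler_powR; rewrite ?nnegrE// ltW.
Qed.

Lemma Lnorm01_triangle p u v : 1 < p -> measurable_fun setT u ->
  measurable_fun setT v ->
  (Lnorm01 p (fun x => u x + v x)%R <= Lnorm01 p u + Lnorm01 p v)%E.
Proof. by move=> p1 meas_u mv; apply: (minkowski_EFin mu meas_u mv);
  exact: ltW. Qed.

Lemma norm_powR_step p N F : 0 < p ->
  (fun x => `|step N F x : R| `^ p) = step N (fun k => `|F k| `^ p).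
Proof.
move=> p0; apply/funext => x.
have h : `|0 : R| `^ p = 0 by rewrite normr0 powR0// gt_eqF.
by rewrite -(@step_comp R (fun y : R => `|y| `^ p) N F x h).
Qed.

Lemma Lnorm01_step p N F : 0 < p ->
  Lnorm01 p (step N F) = ((level_mean N (fun k => `|F k| `^ p)) `^ p^-1)%:E.
Proof.
move=> p0; rewrite Lnorm01E norm_powR_step// ?Rint_step//; exact: intg_step.
Qed.

(** Ratio of the moduli of normalized Haar functions on consecutive levels. *)
Definition haar_ratio p : R := 2 `^ p^-1.

Lemma haar_ratio_gt0 p : 0 < haar_ratio p.
Proof. exact: powR_gt0. Qed.

Lemma haar_ratioP p : 0 < p -> haar_ratio p `^ p = 2.
Proof. by move=> p0; rewrite /haar_ratio -powRrM mulVf ?powRr1// gt_eqF. Qed.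

Lemma haar_ratioM p q : p^-1 + q^-1 = 1 -> haar_ratio p * haar_ratio q = 2.
Proof.
by move=> pq; rewrite /haar_ratio -powRD ?pq ?powRr1//; apply/implyP;
  rewrite oner_eq0.
Qed.

(** By 2^(1/p) = exp(ln 2 / p) and ln 2 >= 1/2. *)
Lemma haar_ratio_ge p : 0 < p -> 1 + (2 * p)^-1 <= haar_ratio p.
Proof.
move=> p0; have ln2 : 2^-1 <= ln 2 :> R.
  have := @le_ln1Dx R (- 2^-1); rewrite (_ : 1 - 2^-1 = 2^-1 :> R); last by lra.
  by rewrite lnV ?posrE//; lra.
have -> : haar_ratio p = expR (p^-1 * ln 2).
  by rewrite /haar_ratio /powR pnatr_eq0.
apply: le_trans (expR_ge1Dx _); rewrite lerD2l invfM mulrC ler_wpM2l//.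
by rewrite invr_ge0 ltW.
Qed.

Lemma haar_ratio_bounds p : 1 < p -> 1 < haar_ratio p /\ haar_ratio p <= 2.
Proof.
move=> p1; have p0 : 0 < p by lra.
split; last first.
  rewrite -[leRHS]powRr1//; apply: ler_powR; first by lra.
  by rewrite invf_le1// ltW.
apply: lt_le_trans (haar_ratio_ge p0).
by rewrite ltrDl invr_gt0; lra.
Qed.

(** The normalized Haar function is [haar_cell] times |I|^(-1/p), which is
    [haar_ratio p] to the power of the level of the support. *)
Lemma haar_real_step p N I : p != 0 -> (haar_level I <= N)%N ->
  haar_real p I =
  step N (fun k => haar_ratio p ^+ (haar_level I).-1 * haar_cell N I k) :> (R -> R).
Proof.
move=> p0 IN; apply/funext => x.
case: I IN => [[n j]|] /= IN; last first.
  rewrite in_itv /=; case: ifPn => x01; first by rewrite step_in// expr0 mulr1.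
  by rewrite step_out.
have p2 (m : nat) : 0 < 2 ^+ m :> R by rewrite exprn_gt0.
have scal : (dyadic_right R (existT _ n j) - dyadic_left R (existT _ n j)) `^ (-
  p^-1)
    = haar_ratio p ^+ n.
  rewrite /dyadic_right /dyadic_left /= -mulrBl -natrB// subSnn mul1r.
  rewrite -powR_invn// -powRrM mulrNN mulrC powRrM powR_mulrn ?powR_ge0//.
rewrite scal.
set D := existT _ n j.
have e1 : dyadic_left R D = j.*2%:R / 2 ^+ n.+1.
  by rewrite /dyadic_left /= -mul2n natrM exprS; field; rewrite gt_eqF.
have e2 : dyadic_mid R D = j.*2.+1%:R / 2 ^+ n.+1.
  rewrite /dyadic_mid /dyadic_left /dyadic_right /=.
  rewrite -[j.*2.+1]addn1 -mul2n natrD natrM exprS -[in j.+1%:R]addn1 natrD.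
  by field; rewrite gt_eqF.
have e3 : dyadic_right R D = j.*2.+2%:R / 2 ^+ n.+1.
  rewrite /dyadic_right /= (_ : j.*2.+2 = j.+1 * 2)%N;
    last by rewrite mulSn muln2 add2n.
  by rewrite natrM exprS; field; rewrite gt_eqF.
have inE' (A : interval R) : (x \in A) = (x \in [set` A]) by rewrite mem_setE.
rewrite e1 e2 e3 (inE' `[_, (_ / _)[) (inE' `[_, (j.*2.+2%:R / _)[).
rewrite -/(dyadic_cell n.+1 j.*2) -/(dyadic_cell n.+1 j.*2.+1).
have jb : (j.*2.+1 < 2 ^ n.+1)%N.
  have := ltn_ord j; rewrite expnS; lia.
case: (boolP (0 <= x < 1)) => x01; last first.
  by rewrite step_out// !notin_dyadic_cell//; lia.
have /andP[x0 _] := x01.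
rewrite step_in// truncn_divn// !in_dyadic_cell// /haar_sign.
case: eqVneq => [->|h1].
  have -> : (j.*2 == j.*2.+1 :> nat) = false by apply/negbTE; lia.
  by rewrite sub0r mulrN1.
by case: eqVneq => h2; rewrite subr0 ?mulr1 ?mulr0.
Qed.

End RealNorm.

(** * The two estimates for integrable functions *)

Section RealBounds.
Context {R : realType}.
Local Notation mu := (lebesgue01 R).
Local Notation T := (measurableTypeR R).
Local Notation intg u := (mu.-integrable setT (EFin \o u)).
Implicit Types (u v : T -> R) (p q : R).

Lemma conj_exponentP p : 1 < p ->
  [/\ 1 < conj_exponent p, p^-1 + (conj_exponent p)^-1 = 1 &
      p * conj_exponent p = p + conj_exponent p].
Proof.
move=> p1; rewrite /conj_exponent.
have pm : 0 < p - 1 by lra.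
have p0 : p != 0 by rewrite gt_eqF//; lra.
have pm0 : p - 1 != 0 by rewrite gt_eqF.
split.
- by rewrite ltr_pdivlMr// mul1r; lra.
- by rewrite invf_div; field.
by field.
Qed.

Lemma haar_level_bound (S : seq (option dyadic)) :
  exists N, forall I, I \in S -> (haar_level I <= N)%N.
Proof.
exists (\max_(I <- S) haar_level I)%N => I IS.
by apply: leq_bigmax_seq.
Qed.

Definition haar_inner p I u : R := Rint (fun x => u x * haar_real (conj_exponent p)
  I x).

Lemma intg_haar p I : p != 0 -> intg (haar_real p I).
Proof. by move=> p0; rewrite (haar_real_step p0 (leqnn (haar_level I)));
  exact: intg_step. Qed.

Lemma measurable_haar p I : p != 0 -> measurable_fun setT (haar_real p I : T -> R).
Proof. by move=> p0; rewrite (haar_real_step p0 (leqnn (haar_level I)));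
  exact: measurable_step. Qed.

Lemma intgM_haar p I u : p != 0 -> intg u -> intg (fun x => u x * haar_real p I x).
Proof. by move=> p0 iu; rewrite (haar_real_step p0 (leqnn (haar_level I)));
  exact: intgM_step. Qed.

(** This is |I|^(-1/q) |I| = |I|^(1/p): it converts coefficients for the
    normalization in L_p into coefficients for modulus 1. *)
Lemma haar_ratio_mass p q I : p^-1 + q^-1 = 1 ->
  haar_ratio q ^+ (haar_level I).-1 * haar_mass I =
  (haar_ratio p ^+ (haar_level I).-1)^-1 :> R.
Proof.
move=> pq; have p0 := haar_ratio_gt0 p; have q0 := haar_ratio_gt0 q.
rewrite /haar_mass -(haar_ratioM pq) -exprMn -exprVn; congr (_ ^+ _).
by field; rewrite !gt_eqF.
Qed.

Lemma haar_innerE p I u : 1 < p -> intg u ->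
  haar_inner p I u = haar_coef (dyadic_avg u) I / haar_ratio p ^+ (haar_level I).-1.
Proof.
move=> p1 iu; have [q1 pq _] := conj_exponentP p1.
have q0 : conj_exponent p != 0 by rewrite gt_eqF//; lra.
rewrite /haar_inner (haar_real_step q0 (leqnn (haar_level I))) Rint_mul_step//.
under eq_level_mean do rewrite -mulrA.
rewrite level_meanZ haar_cell_pairing//; last exact: dyadic_avg_martingale.
by rewrite mulrA (haar_ratio_mass I pq) mulrC.
Qed.

Lemma haar_inner_norm p I u : 1 < p -> intg u ->
  Rint (fun x => u x * `|haar_real (conj_exponent p) I x|) =
  dyadic_avg u (haar_level I).-1 (haar_pos I) / haar_ratio p ^+ (haar_level I).-1.
Proof.
move=> p1 iu; have [q1 pq _] := conj_exponentP p1.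
have q0 : conj_exponent p != 0 by rewrite gt_eqF//; lra.
set q := conj_exponent p.
have r0 : 0 <= haar_ratio q ^+ (haar_level I).-1 by rewrite exprn_ge0// ltW//
  haar_ratio_gt0.
have H x : `|haar_real q I x| = step (haar_level I)
    (fun k => haar_ratio q ^+ (haar_level I).-1 * `|haar_cell (haar_level I) I k|)
      x.
  rewrite (haar_real_step q0 (leqnn (haar_level I))).
  rewrite (@step_comp R Num.norm) ?normr0//; congr (step _ _ x); apply/funext => k.
  by rewrite normrM (ger0_norm r0).
under eq_Rint do rewrite H.
rewrite Rint_mul_step//.
under eq_level_mean do rewrite -mulrA.
rewrite level_meanZ norm_haar_cell_pairing//; last exact: dyadic_avg_martingale.
by rewrite mulrA (haar_ratio_mass I pq) mulrC.
Qed.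

Lemma haar_inner_haar p I J : 1 < p -> haar_inner p I (haar_real p J) = (I == J)%:R.
Proof.
move=> p1; have [q1 pq _] := conj_exponentP p1.
have q0 : conj_exponent p != 0 by rewrite gt_eqF//; lra.
have p0 : p != 0 by rewrite gt_eqF//; lra.
pose N := maxn (haar_level I) (haar_level J).
have IN : (haar_level I <= N)%N by exact: leq_maxl.
have JN : (haar_level J <= N)%N by exact: leq_maxr.
rewrite /haar_inner (haar_real_step p0 JN) (haar_real_step q0 IN).
under eq_Rint do rewrite stepM.
rewrite Rint_step; set r := haar_ratio _; set s := haar_ratio _.
rewrite (@eq_level_mean _ N _ (fun k => (r ^+ (haar_level J).-1 * s ^+ (haar_level
  I).-1) *
   (haar_cell N I k * haar_cell N J k))); last by move=> k _; ring.
rewrite level_meanZ haar_cell_orthogonal//.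
have [<-|_] := eqVneq I J; last by rewrite !mulr0.
rewrite mulr1 -mulrA (haar_ratio_mass I pq) mulfV// expf_neq0// gt_eqF//.
exact: haar_ratio_gt0.
Qed.

Lemma step_haar_sum p N (S : seq (option dyadic)) (c : option dyadic -> R) :
  p != 0 ->
  (forall I, I \in S -> (haar_level I <= N)%N) ->
  (fun x => \sum_(I <- S) c I * haar_real p I x) =
  step N (fun k =>
    \sum_(I <- S) c I * (haar_ratio p ^+ (haar_level I).-1 * haar_cell N I k))
  :> (R -> R).
Proof.
move=> p0 SN; apply/funext => x; rewrite -step_sum big_seq [RHS]big_seq.
by apply: eq_bigr => I IS; rewrite (haar_real_step p0 (SN I IS)) stepZ.
Qed.

(** Unconditionality with constant of order p q: [haar_projection_bound] applied
    to the averages of [u], whose norm [jensen_avg] controls. *)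
Lemma haar_projection_Lnorm p u (S : seq (option dyadic)) : 1 < p ->
  measurable_fun setT u -> uniq S ->
  (Lnorm01 p (fun x => \sum_(I <- S) haar_inner p I u * haar_real p I x)%R <=
   (10 * p * conj_exponent p)%:E * Lnorm01 p u)%E.
Proof.
move=> p1 meas_u uS; have [q1 pq _] := conj_exponentP p1.
have p0 : 0 < p by lra. have q0 : 0 < conj_exponent p by lra.
have C0 : 0 < 10 * p * conj_exponent p by do 2! apply: mulr_gt0 => //.
have [uoo|] := ltP (Lnorm01 p u) +oo%E; last first.
  by rewrite leye_eq => /eqP->; rewrite gt0_muley ?leey// lte_fin.
have [iup iu] := Lnorm01_fin_integrable p1 meas_u uoo.
have [N SN] := haar_level_bound S.
rewrite (step_haar_sum _ _ SN) ?gt_eqF//.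
apply: (Lnorm01_le_scaled p1 (ltW C0) _ iup).
  by rewrite norm_powR_step//; exact: intg_step.
rewrite norm_powR_step// Rint_step.
apply: le_trans (_ : _ <= (10 * p * conj_exponent p) `^ p *
   level_mean N (fun k => `|dyadic_avg u N k| `^ p)) _; last first.
  by rewrite ler_wpM2l ?powR_ge0//; exact: jensen_avg.
apply: le_trans (haar_projection_bound p1 q0 pq uS SN (@dyadic_avg_martingale _ u N
  iu)).
rewrite le_eqVlt; apply/orP; left; apply/eqP; apply: eq_level_mean => k _.
congr (`| _ | `^ _); apply: eq_bigr => I _; rewrite haar_innerE// -mulrA;
  congr (_ * _).
by rewrite mulrA mulVf ?mul1r// expf_neq0// gt_eqF// haar_ratio_gt0.
Qed.

(** Both steps lose one conjugate exponent: [haar_sum_upper] bounds the sum over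
    [A] by the size of [A], with a factor of order p, and [size_le_maximal] bounds
    the size of [B] by the norm of [u], with a factor of order q. *)
Lemma haar_sum_le_Lnorm p u (A B : seq (option dyadic))
    (c : option dyadic -> R) (tau : R) :
  1 < p -> measurable_fun setT u -> uniq A -> uniq B -> (size A <= size B)%N ->
  0 <= tau -> (forall I, I \in A -> `|c I| <= tau) ->
  (forall I, I \in B ->
    tau <= 2 * Rint (fun x => u x * `|haar_real (conj_exponent p) I x|)) ->
  (Lnorm01 p (fun x => \sum_(I <- A) c I * haar_real p I x)%R <=
   (32 * p * conj_exponent p)%:E * Lnorm01 p u)%E.
Proof.
move=> p1 meas_u uA uB AB tau0 cA hB; have [q1 pq _] := conj_exponentP p1.
set q := conj_exponent p in q1 pq hB *.
have p0 : 0 < p by lra. have q0 : 0 < q by lra.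
have C0 : 0 < 32 * p * q by do 2! apply: mulr_gt0 => //.
have [uoo|] := ltP (Lnorm01 p u) +oo%E; last first.
  by rewrite leye_eq => /eqP->; rewrite gt0_muley ?leey// lte_fin.
have [iup iu] := Lnorm01_fin_integrable p1 meas_u uoo.
have [N ABN] := haar_level_bound (A ++ B).
have AN I : I \in A -> (haar_level I <= N)%N by move=> IA; apply: ABN;
  rewrite mem_cat IA.
have BN I : I \in B -> (haar_level I <= N)%N by move=> IB; apply: ABN;
  rewrite mem_cat IB orbT.
rewrite (step_haar_sum _ _ AN) ?gt_eqF//.
apply: (Lnorm01_le_scaled p1 (ltW C0) _ iup).
  by rewrite norm_powR_step//; exact: intg_step.
rewrite norm_powR_step// Rint_step.
apply: le_trans (_ : _ <= (32 * p * q) `^ p *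
   level_mean N (fun k => `|dyadic_avg u N k| `^ p)) _; last first.
  by rewrite ler_wpM2l ?powR_ge0//; exact: jensen_avg.
have [r1 r2] := haar_ratio_bounds p1; set r := haar_ratio p in r1 r2 *.
(* the geometric constant 2 r / (r - 1) is at most 8 p since r - 1 >= 1 / (2 p) *)
have rK : 2 * r <= (8 * p) * (r - 1).
  have h := haar_ratio_ge p0; rewrite -/r in h.
  have : (8 * p) * (2 * p)^-1 <= (8 * p) * (r - 1).
    by rewrite ler_wpM2l ?mulr_ge0 ?(ltW p0)//; lra.
  have -> : 8 * p * (2 * p)^-1 = 4 by field; rewrite gt_eqF.
  lra.
have rp : r `^ p = 2 := haar_ratioP p0.
apply: le_trans (haar_sum_upper p0 r1 r2 rp rK uA AN tau0 cA) _.
have t2 : 0 <= tau / 2 by rewrite divr_ge0.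
have := @size_le_maximal _ p q r (tau / 2) N B (dyadic_avg u) p1 q0 pq r1 rp uB BN
  (@dyadic_avg_martingale _ u N iu) t2.
set L := level_mean N _ => hh.
have {}hh : (tau / 2) `^ p * (size B)%:R <= 2 * q `^ p * L.
  apply: hh => I IB; have := hB I IB; rewrite haar_inner_norm// -/r.
  set a := dyadic_avg _ _ _; have rl : 0 < r ^+ (haar_level I).-1 by rewrite
    exprn_gt0// (lt_trans _ r1).
  move=> h; apply: le_trans (ler_norm a).
  by rewrite -ler_pdivlMr//; lra.
have L0 : 0 <= L by apply: level_mean_ge0 => k; exact: powR_ge0.
apply: (@le_trans _ _ ((16 * p) `^ p * ((tau / 2) `^ p * (size B)%:R))).
  rewrite [leRHS]mulrA -powRM//; last by apply: mulr_ge0 => //; exact: ltW.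
  rewrite (_ : 16 * p * (tau / 2) = tau * (8 * p)); last by field.
  by rewrite ler_wpM2l ?powR_ge0// ler_nat.
apply: (@le_trans _ _ ((16 * p) `^ p * (2 * q `^ p * L))).
  by rewrite ler_wpM2l ?powR_ge0.
clearbody q L; rewrite !mulrA ler_wpM2r// (_ : 32 * p * q = 2 * (16 * p) * q);
  last by ring.
have h16 : 0 <= 16 * p by apply: mulr_ge0 => //; exact: ltW.
rewrite (powRM _ _ (ltW q0)) ?mulr_ge0 ?(ltW p0)// (powRM _ _ h16)// ler_wpM2r
  ?powR_ge0//.
rewrite mulrC ler_wpM2r ?powR_ge0//.
by rewrite -{1}[2]powRr1//; apply: ler_powR; [lra|exact: ltW].
Qed.

End RealBounds.

(** * Real and complex scalars *)

Section Scalars.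
Context {R : realType} {F : scalar_kind}.
Local Notation K := (scalar_field R F).
Implicit Types (z w : K) (r : R).

Lemma scalar_reD z w : scalar_re (z + w) = scalar_re z + scalar_re w.
Proof. by case: F z w => //= z w; exact: raddfD. Qed.

Lemma scalar_imD z w : scalar_im (z + w) = scalar_im z + scalar_im w.
Proof. by case: F z w => //= z w; [rewrite addr0|exact: raddfD]. Qed.

Lemma scalar_reN z : scalar_re (- z) = - scalar_re z.
Proof. by case: F z => //= z; exact: raddfN. Qed.

Lemma scalar_imN z : scalar_im (- z) = - scalar_im z.
Proof. by case: F z => //= z; [rewrite oppr0|exact: raddfN]. Qed.

Lemma scalar_re0 : scalar_re (0 : K) = 0.
Proof. by case: F. Qed.

Lemma scalar_im0 : scalar_im (0 : K) = 0.
Proof. by case: F. Qed.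

Lemma scalar_re_sum (I : Type) (s : seq I) (z : I -> K) :
  scalar_re (\sum_(i <- s) z i) = \sum_(i <- s) scalar_re (z i).
Proof. by elim/big_rec2: _ => [|i x y _ <-]; rewrite ?scalar_re0 ?scalar_reD. Qed.

Lemma scalar_im_sum (I : Type) (s : seq I) (z : I -> K) :
  scalar_im (\sum_(i <- s) z i) = \sum_(i <- s) scalar_im (z i).
Proof. by elim/big_rec2: _ => [|i x y _ <-]; rewrite ?scalar_im0 ?scalar_imD. Qed.

Lemma scalar_reM z r : scalar_re (z * scalar_of_reim F r 0) = scalar_re z * r.
Proof. by case: F z => //= -[a b] /=; rewrite mulr0 subr0. Qed.

Lemma scalar_imM z r : scalar_im (z * scalar_of_reim F r 0) = scalar_im z * r.
Proof. by case: F z => /= [z|[a b] /=]; rewrite ?mul0r// mulr0 add0r. Qed.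

Lemma scalar_of_reimK z : scalar_of_reim F (scalar_re z) (scalar_im z) = z.
Proof. by case: F z => //= -[]. Qed.

Lemma scalar_reK a b : scalar_re (scalar_of_reim F a b) = a :> R.
Proof. by case: F. Qed.

Lemma scalar_absE z : scalar_abs z = Num.sqrt (scalar_re z ^+ 2 + scalar_im z ^+ 2).
Proof.
rewrite /scalar_abs; case: F z => [z|[a b]] /=; last by [].
by rewrite expr0n addr0 sqrtr_sqr.
Qed.

Lemma scalar_abs_ge0 z : 0 <= scalar_abs z.
Proof. by rewrite scalar_absE sqrtr_ge0. Qed.

Lemma norm_re_le z : `|scalar_re z| <= scalar_abs z.
Proof. by rewrite scalar_absE -sqrtr_sqr ler_wsqrtr// lerDl sqr_ge0. Qed.

Lemma norm_im_le z : `|scalar_im z| <= scalar_abs z.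
Proof. by rewrite scalar_absE -sqrtr_sqr ler_wsqrtr// lerDr sqr_ge0. Qed.

Lemma scalar_abs_le z : scalar_abs z <= `|scalar_re z| + `|scalar_im z|.
Proof.
have h : 0 <= `|scalar_re z| + `|scalar_im z| by rewrite addr_ge0.
rewrite scalar_absE -[leRHS]ger0_norm// -sqrtr_sqr ler_wsqrtr// sqrrD.
by rewrite !real_normK ?num_real// lerD2r lerDl mulrn_wge0// mulr_ge0.
Qed.

Lemma scalar_abs_homo z w : `|z| <= `|w| -> scalar_abs z <= scalar_abs w.
Proof.
rewrite /scalar_abs; case: F z w => [//|z w] /=.
by rewrite lecE => /andP[].
Qed.

End Scalars.

(** * The remainder of the greedy algorithm, one real component at a time *)

Section Remainder.
Context {R : realType}.
Local Notation mu := (lebesgue01 R).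
Local Notation T := (measurableTypeR R).
Local Notation intg u := (mu.-integrable setT (EFin \o u)).

Lemma haar_inner_remainder p (u : T -> R) (A : seq (option dyadic))
    (al : option dyadic -> R) I :
  1 < p -> intg u -> uniq A ->
  let w x := u x - \sum_(j <- A) al j * haar_real p j x in
  intg w /\ haar_inner p I w = haar_inner p I u - (if I \in A then al I else 0).
Proof.
move=> p1 iu uA w; have p0 : p != 0 by rewrite gt_eqF//; lra.
have [q1 _ _] := conj_exponentP p1.
have q0 : conj_exponent p != 0 by rewrite gt_eqF//; lra.
have [is1 _] := @Rint_sum R _ A (fun j x => al j * haar_real p j x)
  (fun j => intgZ (al j) (@intg_haar R p j p0)).
have is2 : intg (fun x => -1 * \sum_(j <- A) al j * haar_real p j x) by exact:
  intgZ.
have wE : w = (fun x => u x + -1 * \sum_(j <- A) al j * haar_real p j x).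
  by apply/funext => x; rewrite mulN1r.
have iw : intg w by rewrite wE; exact: intgD.
split => //; rewrite /haar_inner.
pose h := haar_real (conj_exponent p) I : T -> R.
have is3 j : intg (fun x => - al j * (haar_real p j x * h x)).
  by apply: intgZ; apply: intgM_haar => //; exact: intg_haar.
have [is4 e4] := @Rint_sum R _ A (fun j x => - al j * (haar_real p j x * h x)) is3.
rewrite (@eq_Rint _ _ (fun x => u x * h x + \sum_(j <- A) - al j * (haar_real p j x
  * h x))); last first.
  move=> x; rewrite /w mulrBl mulr_suml -sumrN; congr (_ + _).
  by apply: eq_bigr => j _; rewrite /h; ring.
rewrite RintD//; last exact: intgM_haar.
rewrite e4; congr (_ + _).
rewrite (eq_bigr (fun j => - (al j * (I == j)%:R))); last first.
  move=> j _; rewrite RintZ; last by apply: intgM_haar => //; exact: intg_haar.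
  by have := haar_inner_haar I j p1; rewrite /haar_inner => ->; rewrite mulNr.
rewrite sumrN; congr (- _); case: ifP => [IA|IA].
  rewrite (bigD1_seq I)//= eqxx mulr1 big1 ?addr0// => j ji.
  by rewrite eq_sym (negbTE ji) mulr0.
rewrite big_seq big1// => j jA; case: eqVneq => [e|]; last by rewrite mulr0.
by rewrite e jA in IA.
Qed.

(** With w = u - sum_A al_j h_j this reads
    u - P_B u = (w - P_(A u B) w) + P_(A minus B) u; it holds because w and u have
    the same coefficients outside [A] and the subtracted combination is its own
    projection. The union of A and B is listed as (A minus B) followed by B. *)
Lemma remainder_decomposition p (u : T -> R) (A B : seq (option dyadic))
    (al : option dyadic -> R) x :
  1 < p -> intg u -> uniq A -> uniq B ->
  let w x := u x - \sum_(j <- A) al j * haar_real p j x in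
  let c I := haar_inner p I u in
  u x - \sum_(I <- B) c I * haar_real p I x =
  w x - \sum_(I <- [seq I <- A | I \notin B] ++ B) haar_inner p I w * haar_real p I
    x +
  \sum_(I <- [seq I <- A | I \notin B]) c I * haar_real p I x.
Proof.
move=> p1 iu uA uB w c; set D := [seq _ <- _ | _].
have wi I := (haar_inner_remainder al I p1 iu uA).2.
have -> : \sum_(I <- D ++ B) haar_inner p I w * haar_real p I x =
   \sum_(I <- D ++ B) c I * haar_real p I x
   - \sum_(I <- D ++ B) (if I \in A then al I else 0) * haar_real p I x.
  by rewrite -sumrB; apply: eq_bigr => I _; rewrite wi mulrBl.
have -> : \sum_(I <- D ++ B) (if I \in A then al I else 0) * haar_real p I x
   = \sum_(j <- A) al j * haar_real p j x.
  transitivity (\sum_(I <- D ++ B | I \in A) al I * haar_real p I x).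
    by rewrite [RHS]big_mkcond; apply: eq_bigr => I _; case: ifP; rewrite ?mul0r.
  rewrite -big_filter; apply: perm_big; apply: uniq_perm => //.
    rewrite filter_uniq// cat_uniq filter_uniq// uB andbT /=.
    by apply/hasPn => I IB; rewrite /= mem_filter IB.
  move=> I; rewrite mem_filter mem_cat mem_filter; case: (I \in A) => //=.
  by case: (I \in B).
rewrite big_cat /= /w; ring.
Qed.

(** The first two terms of [remainder_decomposition] cost 1 + 10 p q, the third
    one 32 p q. The function [G] dominates [w] and carries the size information on
    the coefficients over [E]; for complex scalars [u] is the real or imaginary
    part, while [G] is the full modulus. *)
Lemma Lnorm01_remainder_le p (u G : T -> R) (A B : seq (option dyadic))
    (al : option dyadic -> R) tau :
  1 < p -> intg u -> measurable_fun setT G -> uniq A -> uniq B ->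
  let D := [seq I <- A | I \notin B] in
  let E := [seq I <- B | I \notin A] in
  let w x := u x - \sum_(j <- A) al j * haar_real p j x in
  (forall x, `|w x| <= `|G x|) -> (size D <= size E)%N -> 0 <= tau ->
  (forall I, I \in D -> `|haar_inner p I u| <= tau) ->
  (forall I, I \in E ->
    tau <= 2 * Rint (fun x => G x * `|haar_real (conj_exponent p) I x|)) ->
  (Lnorm01 p (fun x => u x - \sum_(I <- B) haar_inner p I u * haar_real p I x)%R
   <= (1 + 42 * (p * conj_exponent p))%:E * Lnorm01 p G)%E.
Proof.
move=> p1 iu mG uA uB D E w wG DE tau0 hD hE.
have p0 : p != 0 by rewrite gt_eqF//; lra.
have [q1 pq _] := conj_exponentP p1.
have iw : intg w := (haar_inner_remainder al None p1 iu uA).1.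
have mw := intg_measurable iw.
rewrite (_ : (fun x => _) = (fun x => (w x + - (\sum_(I <- D ++ B) haar_inner p I w
  * haar_real p I x)) +
    \sum_(I <- D) haar_inner p I u * haar_real p I x)); last first.
  by apply/funext => x; exact: remainder_decomposition.
have msum (S : seq (option dyadic)) (c : option dyadic -> R) :
    measurable_fun setT (fun x : T => \sum_(I <- S) c I * haar_real p I x).
  by apply: measurable_sum => I; apply: measurable_funM => //;
    exact: measurable_haar.
have mN (v : T -> R) : measurable_fun setT v -> measurable_fun setT (fun x =>
  - v x).
  by move=> mv; exact: measurable_funN.
have mwS : measurable_fun setT (fun x => w x + - \sum_(I <- D ++ B) haar_inner p I
  w * haar_real p I x).
  by apply: measurable_funD => //; exact: mN.
apply: le_trans (Lnorm01_triangle p1 mwS (msum _ _)) _.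
have uDB : uniq (D ++ B).
  rewrite cat_uniq filter_uniq// uB andbT /=.
  by apply/hasPn => I IB; rewrite /= mem_filter IB.
have h1 : (Lnorm01 p w <= Lnorm01 p G)%E by apply: Lnorm01_mono.
have h2 := haar_projection_Lnorm p1 mw uDB.
have h3 := haar_sum_le_Lnorm p1 mG (filter_uniq _ uA) (filter_uniq _ uB) DE tau0 hD
  hE.
have h4 := Lnorm01_triangle p1 mw (mN _ (msum (D ++ B) (fun I =>
  haar_inner p I w))).
have h5 : (Lnorm01 p (fun x => - \sum_(I <- D ++ B) haar_inner p I w * haar_real p
  I x)%R <=
   (10 * p * conj_exponent p)%:E * Lnorm01 p w)%E.
  apply: le_trans h2; apply: Lnorm01_mono => //; first exact: mN.
  by move=> x; rewrite normrN.
have pp0 : 0 <= p by lra.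
have pq0 : 0 <= conj_exponent p by lra.
have c1 : 0 <= 10 * p * conj_exponent p by apply: mulr_ge0 => //; exact: mulr_ge0.
have c2 : 0 <= 32 * p * conj_exponent p by apply: mulr_ge0 => //; exact: mulr_ge0.
apply: (@le_trans _ _ (Lnorm01 p G + (10 * p * conj_exponent p)%:E * Lnorm01 p G +
   (32 * p * conj_exponent p)%:E * Lnorm01 p G)%E).
  apply: leeD => //; apply: le_trans h4 _; apply: leeD => //.
  apply: le_trans h5 _; by apply: lee_wpmul2l; rewrite ?lee_fin.
have N0 : (0 <= Lnorm01 p G)%E by exact: Lnorm_ge0.
rewrite -[X in (X + _ + _ <= _)%E]mul1e -!ge0_muleDl ?lee_fin ?addr_ge0//.
rewrite -!EFinD lee_wpmul2r// lee_fin; lra.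
Qed.

End Remainder.

(** * Sets chosen by a greedy ordering *)

Section GreedyPrefix.
Context {K : numFieldType} {J : choiceType}.

Definition prefix (rho : nat -> J) m : seq J := [seq rho n | n <- iota 0 m].

Lemma prefix_uniq rho m : injective rho -> uniq (prefix rho m).
Proof. by move=> inj; rewrite map_inj_uniq ?iota_uniq. Qed.

Lemma size_prefix rho m : size (prefix rho m) = m.
Proof. by rewrite size_map size_iota. Qed.

(** An index outside the range of [rho] can only occur for infinite support, and
    then its coefficient vanishes. *)
Lemma greedy_prefix_dominates sigma (c : J -> K) rho m i j :
  is_greedy_ordering sigma c rho -> i \in prefix rho m -> j \notin prefix rho m ->
  `|c j| <= `|c i|.
Proof.
move=> [_ homo _ hinf hfin] /mapP[n nm ->] jm.
have [[k ek]|jr] := pselect (exists k, rho k = j).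
  rewrite -ek; apply: homo; rewrite leqNgt; apply/negP => kn.
  move/negP: jm; apply; apply/mapP; exists k => //.
  by move: nm; rewrite !mem_iota /= !add0n; exact: ltn_trans.
have -> : c j = 0; last by rewrite normr0.
apply/eqP/negPn/negP => cj.
have [fin|inf] := pselect (finite_set [set j | c j != 0]).
  have : [set: J] j by []; rewrite -(hfin fin) => -[k _ ek]; apply: jr; by exists k.
have : [set j | c j != 0] j by []; rewrite -(hinf inf) => -[k _ ek]; apply: jr;
  by exists k.
Qed.

Lemma size_filter_notin (A B : seq J) : uniq A -> uniq B -> size A = size B ->
  size [seq i <- A | i \notin B] = size [seq i <- B | i \notin A].
Proof.
move=> uA uB AB; rewrite !size_filter.
have e : count (mem B) A = count (mem A) B.
  rewrite -!size_filter; apply: perm_size; apply: uniq_perm; rewrite ?filter_uniq//.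
  by move=> i; rewrite !mem_filter andbC.
have := count_predC (mem B) A; have := count_predC (mem A) B.
rewrite -e AB => <- /eqP; rewrite eqn_add2l => /eqP; exact.
Qed.

End GreedyPrefix.

(** * The upper bound *)

Section UpperBound.
Context {R : realType} {F : scalar_kind}.
Local Notation mu := (lebesgue01 R).
Local Notation T := (measurableTypeR R).
Local Notation K := (scalar_field R F).
Local Notation functions := (T -> K^o).
Local Notation intg u := (mu.-integrable setT (EFin \o u)).
Implicit Types (f g : functions).

Definition re_part f : T -> R := fun x => scalar_re (f x).
Definition im_part f : T -> R := fun x => scalar_im (f x).
Definition modulus f : T -> R := fun x => scalar_abs (f x).

Lemma Lp_normE p f : Lp_norm p f = Lnorm01 p (modulus f).
Proof. by []. Qed.

Lemma haar_functional_re p I f :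
  scalar_re (haar_functional p I f) = haar_inner p I (re_part f).
Proof.
rewrite /haar_functional /scalar_integral scalar_reK; apply: eq_Rint => x.
by rewrite /haar scalar_reM.
Qed.

Lemma haar_functional_im p I f :
  scalar_im (haar_functional p I f) = haar_inner p I (im_part f).
Proof.
transitivity (Rint (fun x => scalar_im (f x * haar F (conj_exponent p) I x)));
  last first.
  by apply: eq_Rint => x; rewrite /haar scalar_imM.
rewrite /haar_functional /scalar_integral.
case: F f => f //=; rewrite /Rint /Rintegral integral0//.
Qed.

Lemma re_part_haar_sum p (s : seq (option dyadic)) (a : option dyadic -> K) f x :
  re_part (f - \sum_(j <- s) a j *: (haar F p j : functions)) x =
  re_part f x - \sum_(j <- s) scalar_re (a j) * haar_real p j x.
Proof.
rewrite /re_part !fctE fct_sumE scalar_reD scalar_reN; congr (_ - _).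
by rewrite scalar_re_sum; apply: eq_bigr => j _; rewrite -scalar_reM.
Qed.

Lemma im_part_haar_sum p (s : seq (option dyadic)) (a : option dyadic -> K) f x :
  im_part (f - \sum_(j <- s) a j *: (haar F p j : functions)) x =
  im_part f x - \sum_(j <- s) scalar_im (a j) * haar_real p j x.
Proof.
rewrite /im_part !fctE fct_sumE scalar_imD scalar_imN; congr (_ - _).
by rewrite scalar_im_sum; apply: eq_bigr => j _; rewrite -scalar_imM.
Qed.

Lemma greedy_sumE p (c : option dyadic -> K) rho m :
  greedy_sum (haar F p : option dyadic -> functions) c rho m =
  \sum_(j <- prefix rho m) c j *: (haar F p j : functions).
Proof.
by rewrite /greedy_sum /prefix big_map -(big_mkord xpredT (fun n =>
  c (rho n) *: (haar F p (rho n) : functions))) /index_iota subn0.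
Qed.

Lemma measurable_modulus f : measurable_fun setT (re_part f) ->
  measurable_fun setT (im_part f) -> measurable_fun setT (modulus f).
Proof.
move=> mr mi; rewrite (_ : modulus f = (fun x => Num.sqrt (re_part f x ^+ 2 +
  im_part f x ^+ 2))).
  apply: (@measurableT_comp _ _ _ _ _ _ (@Num.sqrt R)).
    by apply: continuous_measurable_fun; exact: sqrt_continuous.
  by apply: measurable_funD; exact: measurable_funX.
by apply/funext => x; rewrite /modulus scalar_absE.
Qed.

(** [Lnorm01_remainder_le] for the real and for the imaginary part, with the same
    threshold tau. *)
Lemma haar_greedy_bound p sigma : 1 < p ->
  greedy_bound (@Lp_space R F p) (@Lp_norm R F p) (haar F p) (haar_functional p)
    sigma
    (86 * (p * conj_exponent p)).
Proof.
move=> p1 m f rho A a [mre mim ffin] gr Am.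
set c := (fun j => haar_functional p j f).
rewrite greedy_sumE -/c; set B := prefix rho m.
set g := f - \sum_(j <- A) _; set h := f - _.
have [rho_inj _ _ _ _] := gr.
have uA : uniq A := fset_uniq A.
have uB : uniq B := prefix_uniq m rho_inj.
have p0 : p != 0 by rewrite gt_eqF//; lra.
have [q1 pq pqD] := conj_exponentP p1.
have mmod := measurable_modulus mre mim.
have part_int (u : T -> R) : measurable_fun setT u -> (forall x,
  `|u x| <= modulus f x) -> intg u.
  move=> meas_u uf; apply: (Lnorm01_fin_integrable p1 meas_u _).2.
  apply: le_lt_trans ffin; apply: Lnorm01_mono => // x.
  by rewrite [leRHS]ger0_norm ?scalar_abs_ge0.
have ire : intg (re_part f) by apply: part_int => // x; exact: norm_re_le.
have iim : intg (im_part f) by apply: part_int => // x; exact: norm_im_le.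
have regE : re_part g = fun x => re_part f x - \sum_(j <- A) scalar_re (a j) *
  haar_real p j x.
  by apply/funext => x; exact: re_part_haar_sum.
have imgE : im_part g = fun x => im_part f x - \sum_(j <- A) scalar_im (a j) *
  haar_real p j x.
  by apply/funext => x; exact: im_part_haar_sum.
have irg : intg (re_part g) by rewrite regE; exact: (haar_inner_remainder _ None p1
  ire uA).1.
have iig : intg (im_part g) by rewrite imgE; exact: (haar_inner_remainder _ None p1
  iim uA).1.
have mG : measurable_fun setT (modulus g).
  by apply: measurable_modulus; exact: intg_measurable.
pose D := [seq I <- (A : seq _) | I \notin B]; pose E :=
  [seq I <- B | I \notin (A : seq _)].
(* The largest coefficient over A minus B; greediness makes it a lower bound
   for the coefficients over B minus A, where f and g have the same ones. *)
pose tau := \big[Num.max/0]_(I <- D) scalar_abs (c I).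
have tau0 : 0 <= tau by rewrite /tau; elim/big_rec: _ => [//|i x _ x0];
  rewrite le_max x0 orbT.
have tauD I : I \in D -> scalar_abs (c I) <= tau
  by move=> ID; exact: (le_bigmax_seq 0 I xpredT (fun I =>
    scalar_abs (c I)) ID isT).
have DE : (size D <= size E)%N.
  by rewrite (@size_filter_notin _ A B)// size_prefix.
have modG : forall x, 0 <= modulus g x by move=> x; exact: scalar_abs_ge0.
have [Goo|] := ltP (Lnorm01 p (modulus g)) +oo%E; last first.
  rewrite leye_eq Lp_normE Lp_normE => /eqP->; rewrite gt0_muley ?leey// lte_fin.
  by rewrite pqD; lra.
have iG : intg (modulus g) := (Lnorm01_fin_integrable p1 mG Goo).2.
have part_bound (u : T -> R) I : intg u -> (forall x, `|u x| <= modulus g x) ->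
    `|haar_inner p I u| <= Rint (fun x => modulus g x * `|haar_real (conj_exponent
      p) I x|).
  move=> iu uG; have q0 : conj_exponent p != 0 by rewrite gt_eqF//; lra.
  have i1 := intgM_haar I q0 iu; have i2 := intgM_haar I q0 iG.
  apply: le_trans (ler_norm_Rint i1) _; apply: le_Rint.
  - exact: integrable_norm.
  - have := integrable_norm i2; apply: eq_integrable => // x _.
    by rewrite /= normrM ger0_norm.
  by move=> x; rewrite normrM ler_wpM2r.
have tauE I : I \in E -> tau <= 2 * Rint (fun x =>
  modulus g x * `|haar_real (conj_exponent p) I x|).
  rewrite mem_filter => /andP[IA IB].
  have h1 : tau <= scalar_abs (c I).
    rewrite /tau big_seq; elim/big_rec: _ => [|J x JD xc];
      first exact: scalar_abs_ge0.
    rewrite ge_max xc andbT; apply: scalar_abs_homo.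
    by apply: (greedy_prefix_dominates gr IB); move: JD; rewrite mem_filter =>
      /andP[].
  apply: le_trans h1 _; apply: le_trans (scalar_abs_le _) _.
  have := part_bound _ I irg (fun x => norm_re_le (g x)).
  have := part_bound _ I iig (fun x => norm_im_le (g x)).
  rewrite regE imgE (haar_inner_remainder _ I p1 ire uA).2 (haar_inner_remainder _
    I p1 iim uA).2.
  rewrite (negbTE IA) !subr0 -haar_functional_re -haar_functional_im -/(c I).
  lra.
have br := @Lnorm01_remainder_le R p (re_part f) (modulus g) A B (fun j =>
  scalar_re (a j)) tau p1 ire mG uA uB.
have bi := @Lnorm01_remainder_le R p (im_part f) (modulus g) A B (fun j =>
  scalar_im (a j)) tau p1 iim mG uA uB.
have {}br : (Lnorm01 p (re_part h) <= (1 + 42 * (p * conj_exponent p))%:E * Lnorm01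
  p (modulus g))%E.
  have -> : re_part h = (fun x => re_part f x - \sum_(I <- B) haar_inner p I
    (re_part f) * haar_real p I x).
    apply/funext => x; rewrite re_part_haar_sum; congr (_ - _).
    by apply: eq_bigr => I _; rewrite haar_functional_re.
  apply: br => // [x|I ID].
    by rewrite [leRHS]ger0_norm// -[X in `|X|]/((fun x => _) x) -regE;
      exact: norm_re_le.
  by rewrite -haar_functional_re; apply: le_trans (norm_re_le _) (tauD I ID).
have {}bi : (Lnorm01 p (im_part h) <= (1 + 42 * (p * conj_exponent p))%:E * Lnorm01
  p (modulus g))%E.
  have -> : im_part h = (fun x => im_part f x - \sum_(I <- B) haar_inner p I
    (im_part f) * haar_real p I x).
    apply/funext => x; rewrite im_part_haar_sum; congr (_ - _).
    by apply: eq_bigr => I _; rewrite haar_functional_im.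
  apply: bi => // [x|I ID].
    by rewrite [leRHS]ger0_norm// -[X in `|X|]/((fun x => _) x) -imgE;
      exact: norm_im_le.
  by rewrite -haar_functional_im; apply: le_trans (norm_im_le _) (tauD I ID).
have mrh : measurable_fun setT (re_part h).
  rewrite (_ : re_part h = (fun x => re_part f x - \sum_(I <- B) scalar_re (c I) *
    haar_real p I x)).
    exact: intg_measurable (haar_inner_remainder _ None p1 ire uB).1.
  by apply/funext => x; exact: re_part_haar_sum.
have mih : measurable_fun setT (im_part h).
  rewrite (_ : im_part h = (fun x => im_part f x - \sum_(I <- B) scalar_im (c I) *
    haar_real p I x)).
    exact: intg_measurable (haar_inner_remainder _ None p1 iim uB).1.
  by apply/funext => x; exact: im_part_haar_sum.
have mn (u : T -> R) : measurable_fun setT u -> measurable_fun setT (fun x =>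
  `|u x|).
  by move=> meas_u; exact: measurableT_comp.
have Nn (u : T -> R) : measurable_fun setT u -> (Lnorm01 p (fun x =>
  `|u x|)%R <= Lnorm01 p u)%E.
  by move=> meas_u; apply: Lnorm01_mono => //; [exact: mn|move=> x;
    rewrite normr_id].
rewrite !Lp_normE.
apply: (@le_trans _ _ (Lnorm01 p (fun x => `|re_part h x| + `|im_part h x|)%R)).
  apply: Lnorm01_mono => //; first exact: measurable_modulus.
    by apply: measurable_funD; exact: mn.
  move=> x; rewrite [leLHS]ger0_norm ?scalar_abs_ge0// [leRHS]ger0_norm ?addr_ge0//.
  exact: scalar_abs_le.
apply: le_trans (Lnorm01_triangle p1 (mn _ mrh) (mn _ mih)) _.
apply: (@le_trans _ _ ((1 + 42 * (p * conj_exponent p))%:E * Lnorm01 p (modulus g) +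
   (1 + 42 * (p * conj_exponent p))%:E * Lnorm01 p (modulus g))%E).
  by apply: leeD; [exact: le_trans (Nn _ mrh) br|exact: le_trans (Nn _ mih) bi].
have N0 : (0 <= Lnorm01 p (modulus g))%E by exact: Lnorm_ge0.
have C1 : 1 <= p * conj_exponent p by rewrite pqD; lra.
have C0 : 0 <= 1 + 42 * (p * conj_exponent p) by lra.
rewrite -ge0_muleDl ?lee_fin//; rewrite -EFinD lee_wpmul2r// lee_fin.
by rewrite pqD in C1 *; lra.
Qed.

Lemma haar_greedy_constant_le (p : R) sigma : 1 < p ->
  (@haar_greedy_constant R F p sigma <= (172 * Num.max p (conj_exponent p))%:E)%E.
Proof.
move=> p1; have [q1 _ pqD] := conj_exponentP p1.
apply: (@le_trans _ _ (86 * (p * conj_exponent p))%:E); last first.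
  rewrite lee_fin pqD.
  have : p <= Num.max p (conj_exponent p) by rewrite le_max lexx.
  have : conj_exponent p <= Num.max p (conj_exponent p) by rewrite le_max lexx orbT.
  lra.
apply: ereal_inf_lbound; exists (86 * (p * conj_exponent p)) => //; split.
  by rewrite pqD; lra.
exact: haar_greedy_bound.
Qed.

End UpperBound.

(** * Nested and disjoint families of intervals *)

Section Examples.
Context {R : realType}.
Implicit Types (p q r : R) (n k : nat).

Definition left_interval k : option dyadic :=
  Some (existT _ k (Ordinal (expn_gt0 2 k))).

Definition nested_intervals n : seq (option dyadic) :=
  [seq left_interval k | k <- iota 0 n].

(** Disjoint intervals of length 2^-n. Number 0 is skipped to stay off the
    intervals [0, 2^-k). *)
Definition spread_intervals n : seq (option dyadic) :=
  [seq Some (existT (fun n => 'I_(2 ^ n)) n j) | j : 'I_(2 ^ n) <- enum 'I_(2 ^ n)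
    & (0 < j <= n)%N].

Lemma nested_uniq n : uniq (nested_intervals n).
Proof. by rewrite map_inj_uniq ?iota_uniq// => i j /(f_equal haar_level) []. Qed.

Lemma spread_uniq n : uniq (spread_intervals n).
Proof.
rewrite map_inj_uniq => [|i j /(f_equal haar_pos) /= e]; last exact: val_inj.
exact/filter_uniq/enum_uniq.
Qed.

Lemma size_nested n : size (nested_intervals n) = n.
Proof. by rewrite size_map size_iota. Qed.

Lemma size_spread n : size (spread_intervals n) = n.
Proof.
rewrite size_map -[X in _ = X](size_iota 1 n) -(size_map (@nat_of_ord (2 ^ n))).
apply: perm_size; apply: uniq_perm; rewrite ?iota_uniq//.
  by rewrite map_inj_uniq; [exact/filter_uniq/enum_uniq|exact: ord_inj].
move=> i; rewrite mem_iota add1n ltnS; apply/mapP/idP => [[j]|].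
  by rewrite mem_filter => /andP[h _] ->.
move=> h; have i2 : (i < 2 ^ n)%N by case/andP: h => _ h; apply: leq_ltn_trans h _;
  exact: ltn_expl.
by exists (Ordinal i2) => //; rewrite mem_filter /= h mem_enum.
Qed.

Lemma nested_spread_disjoint n I : I \in nested_intervals n ->
  I \notin spread_intervals n.
Proof.
move=> /mapP[k _ ->]; apply/mapP => -[j]; rewrite mem_filter =>
  /andP[/andP[j0 _] _] e.
by have := f_equal haar_pos e; rewrite /= => e'; rewrite -e' in j0.
Qed.

Lemma nested_level n I : I \in nested_intervals n -> (haar_level I <= n)%N.
Proof. by move=> /mapP[k]; rewrite mem_iota => /andP[_ kn] ->. Qed.

Lemma spread_level n I : I \in spread_intervals n -> (haar_level I <= n.+1)%N.
Proof. by move=> /mapP[j _ ->]. Qed.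

(** The supports are disjoint, so at most one term is nonzero at each point. *)
Lemma spread_mean p r n : 0 < p -> 0 < r -> r `^ p = 2 ->
  level_mean n.+1 (fun k => `|\sum_(I <- spread_intervals n)
     1 * (r ^+ (haar_level I).-1 * haar_cell n.+1 I k)| `^ p) = n%:R.
Proof.
move=> p0 r0 rp.
transitivity (level_mean n.+1 (fun k => 2 ^+ n * ((0 < k./2 <= n)%N)%:R : R));
  last first.
  rewrite (level_mean_halfn n (fun k => 2 ^+ n * ((0 < k <= n)%N)%:R : R)).
  rewrite level_meanZ /level_mean mulrA -exprMn mulfV ?pnatr_eq0// expr1n mul1r.
  rewrite -[in RHS](size_spread n) size_map size_filter -sum1_count natr_sum.
  rewrite big_enum_cond /= [RHS]big_mkcond /=; apply: eq_bigr => i _.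
  by case: (0 < i <= n)%N.
apply: eq_level_mean => k kn.
rewrite big_map big_filter big_enum_cond /=.
under eq_bigr do rewrite subnn divn1 mul1r.
rewrite -mulr_sumr normrM (ger0_norm (exprn_ge0 _ (ltW r0))) powRM ?exprn_ge0 ?(ltW
  r0)//.
rewrite -[r ^+ n]powR_mulrn ?(ltW r0)// powRAC rp powR_mulrn//; congr (_ * _).
have k2 : (k./2 < 2 ^ n)%N by move: kn; rewrite expnS; lia.
have z (i : 'I_(2 ^ n)) : i != Ordinal k2 -> haar_sign i k = 0 :> R.
  move=> ik; apply/eqP; rewrite -normr_eq0 norm_haar_sign.
  by move: ik; rewrite -val_eqE /= eq_sym => /negbTE->.
have [h|h] := boolP (0 < k./2 <= n)%N.
  rewrite (bigD1 (Ordinal k2)) //= big1 ?addr0; last by move=> i /andP[_]; exact: z.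
  by rewrite norm_haar_sign eqxx powR1.
rewrite big1 ?normr0 ?powR0 ?gt_eqF// => i ih; apply: z.
by apply: contraNneq h => e; rewrite e in ih.
Qed.

Definition geom_sum r n : R := \sum_(i < n) r ^+ i.
Definition nested_cell r n k : R :=
  \sum_(I <- nested_intervals n) 1 * (r ^+ (haar_level I).-1 * haar_cell n I k).

Lemma nested_cellE r n k :
  nested_cell r n k = \sum_(i < n) r ^+ i * haar_sign 0 (k %/ 2 ^ (n - i.+1)).
Proof.
rewrite /nested_cell big_map -(big_mkord xpredT
  (fun i => r ^+ i * haar_sign 0 (k %/ 2 ^ (n - i.+1)))) /index_iota subn0.
by apply: eq_bigr => i _; rewrite mul1r.
Qed.

Lemma nested_cellS r n k :
  nested_cell r n.+1 k = nested_cell r n k./2 + r ^+ n * haar_sign 0 k.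
Proof.
rewrite !nested_cellE big_ord_recr /= subnn divn1; congr (_ + _).
apply: eq_bigr => i _; congr (_ * haar_sign 0 _).
by rewrite (_ : (n.+1 - i.+1)%N = (n - i.+1).+1) ?expnS ?divnMA ?divn2//; have :=
  ltn_ord i; lia.
Qed.

Lemma haar_sign0 : haar_sign 0 0 = -1 :> R.
Proof. by rewrite /haar_sign /= sub0r. Qed.

Lemma nested_cell0 r n : nested_cell r n 0 = - geom_sum r n.
Proof.
rewrite nested_cellE /geom_sum -sumrN; apply: eq_bigr => i _.
by rewrite div0n haar_sign0 mulrN1.
Qed.

(** The summand for j < n is the contribution of the right half of [0, 2^-j),
    where the first j terms of the sum are negative and the next one is positive;
    the first summand is the contribution of [0, 2^-n). *)
Lemma nested_mean p r n : 1 < p -> 0 < r ->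
  level_mean n (fun k => `|nested_cell r n k| `^ p) =
  2^-1 ^+ n * geom_sum r n `^ p +
  \sum_(j < n) 2^-1 ^+ j.+1 * `|geom_sum r j - r ^+ j| `^ p.
Proof.
move=> p1 r0; have p0 : p != 0 by rewrite gt_eqF//; lra.
have g0 n' : 0 <= geom_sum r n' by apply: sumr_ge0 => i _; rewrite exprn_ge0// ltW.
elim: n => [|n IH].
  rewrite level_mean0 big_ord0 addr0 nested_cell0 normrN expr0 mul1r.
  by rewrite ger0_norm.
rewrite level_meanS.
transitivity (level_mean n (fun k => `|nested_cell r n k| `^ p + (k == 0%N)%:R *
    ((geom_sum r n.+1 `^ p + `|geom_sum r n - r ^+ n| `^ p) / 2 - geom_sum r n `^
      p))).
  apply: eq_level_mean => k _; rewrite !nested_cellS doubleK /= uphalf_double.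
  have [->|k0] := eqVneq k 0%N.
    rewrite haar_sign0 (_ : haar_sign 0 1 = 1 :> R);
      last by rewrite /haar_sign /= subr0.
    rewrite nested_cell0 mulrN1 mulr1 mul1r normrN (ger0_norm (g0 n)) -opprD normrN.
    have -> : geom_sum r n + r ^+ n = geom_sum r n.+1 by rewrite /geom_sum
      big_ord_recr.
    by rewrite (ger0_norm (g0 _)) [- _ + _]addrC distrC addrCA subrr addr0.
  have -> : haar_sign 0 k.*2 = 0 :> R.
    by rewrite /haar_sign [X in X%:R - _](_ : _ = 0%N) ?[X in _ - X%:R](_ : _ =
      0%N) ?subrr//; case: k k0.
  have -> : haar_sign 0 k.*2.+1 = 0 :> R.
    by rewrite /haar_sign [X in X%:R - _](_ : _ = 0%N) ?[X in _ - X%:R](_ : _ =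
      0%N) ?subrr//; case: k k0.
  by rewrite !mulr0 !addr0 mul0r addr0; lra.
rewrite level_meanD IH level_mean_delta ?expn_gt0// big_ord_recr /= exprS.
set S := \sum_(_ < _) _; lra.
Qed.

End Examples.

(** * Norms of the nested and disjoint sums *)

Section ExampleNorms.
Context {R : realType}.
Implicit Types (p q r : R) (n k : nat).
Local Notation T := (measurableTypeR R).

Definition haar_sum p (S : seq (option dyadic)) : T -> R :=
  fun x => \sum_(I <- S) 1 * haar_real p I x.

Lemma Lnorm01_spread p n : 1 < p -> Lnorm01 p (haar_sum p (spread_intervals n)) =
  (n%:R `^ p^-1)%:E.
Proof.
move=> p1; have p0 : 0 < p by lra.
rewrite /haar_sum (@step_haar_sum R p n.+1 _ (fun=> 1)) ?gt_eqF//;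
  last exact: spread_level.
rewrite Lnorm01_step//; congr ((_ `^ _)%:E).
by rewrite spread_mean// ?haar_ratio_gt0// haar_ratioP.
Qed.

Lemma Lnorm01_nested p n : 1 < p -> Lnorm01 p (haar_sum p (nested_intervals n)) =
  ((2^-1 ^+ n * geom_sum (haar_ratio p) n `^ p +
  \sum_(j < n) 2^-1 ^+ j.+1 *
    `|geom_sum (haar_ratio p) j - haar_ratio p ^+ j| `^ p) `^ p^-1)%:E.
Proof.
move=> p1; have p0 : 0 < p by lra.
rewrite /haar_sum (@step_haar_sum R p n _ (fun=> 1)) ?gt_eqF//;
  last exact: nested_level.
rewrite Lnorm01_step//; congr ((_ `^ _)%:E).
by apply: nested_mean => //; exact: haar_ratio_gt0.
Qed.

Lemma geom_sumE r n : geom_sum r n * (r - 1) = r ^+ n - 1.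
Proof. by rewrite mulrC /geom_sum -subrX1. Qed.

(** Young's inequality for 2^(1/p) and 1. *)
Lemma haar_ratio_le p : 1 < p -> haar_ratio p <= 1 + p^-1.
Proof.
move=> p1; have p0 : 0 < p by lra.
have [q1 pq _] := conj_exponentP p1.
have q0 : 0 < conj_exponent p by lra.
have := conjugate_powR (ltW (haar_ratio_gt0 p)) ler01 p0 q0 pq.
rewrite mulr1 haar_ratioP// powR1 div1r; lra.
Qed.

Lemma haar_ratioX p n : 0 < p -> 2^-1 ^+ n * (haar_ratio p ^+ n) `^ p = 1.
Proof.
move=> p0; rewrite -powR_mulrn ?(ltW (haar_ratio_gt0 p))// powRAC haar_ratioP//.
by rewrite powR_mulrn// -exprMn mulVf ?expr1n// pnatr_eq0.
Qed.

(** Here r - 1 <= 1 / p, so the geometric sum is at least p (r^j - 1), and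
    2 p <= j ensures r^j >= 4. *)
Lemma nested_term_lower p j : 2 <= p -> 2 * p <= j%:R ->
  2^-1 * (p / 4) `^ p <=
  2^-1 ^+ j.+1 * `|geom_sum (haar_ratio p) j - haar_ratio p ^+ j| `^ p.
Proof.
move=> p2 pj; have p1 : 1 < p by lra. have p0 : 0 < p by lra.
set r := haar_ratio p; have [r1 _] := haar_ratio_bounds p1; rewrite -/r in r1.
have r0 : 0 < r by lra.
have rj : 4 <= r ^+ j.
  rewrite -powR_mulrn ?(ltW r0)//; apply: (@le_trans _ _ (r `^ (2 * p))).
    by rewrite mulrC powRrM haar_ratioP// powR_mulrn//; lra.
  by apply: ler_powR => //; exact: ltW.
have rp := haar_ratio_le p1; rewrite -/r in rp.
have g : p * (r ^+ j - 1) <= geom_sum r j.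
  have h := geom_sumE r j.
  have r11 : 0 < r - 1 by lra.
  rewrite -(ler_pM2r r11) h -mulrA mulrCA ler_piMr//; first by lra.
  have : p * (r - 1) <= p * p^-1 by rewrite ler_pM2l//; lra.
  by rewrite mulfV// gt_eqF.
have key : p / 4 * r ^+ j <= `|geom_sum r j - r ^+ j|.
  apply: le_trans (ler_norm _).
  have : 0 <= (r ^+ j - 4) * (3 * p / 4 - 1) by apply: mulr_ge0; lra.
  nra.
have h0 : 0 <= p / 4 by rewrite divr_ge0// ltW.
apply: (@le_trans _ _ (2^-1 ^+ j.+1 * (p / 4 * r ^+ j) `^ p)).
  rewrite [in leRHS](powRM _ h0 (exprn_ge0 _ (ltW r0))) exprS -mulrA;
    apply: ler_wpM2l => //.
  by rewrite mulrCA haar_ratioX// mulr1.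
rewrite ler_wpM2l ?exprn_ge0//; apply: ge0_ler_powR; rewrite ?nnegrE//;
  first exact: ltW.
by rewrite mulr_ge0// exprn_ge0// ltW.
Qed.

(** With n = 2 m and m >= 2 p, half of the terms satisfy [nested_term_lower]. *)
Lemma Lnorm01_nested_lower p : 2 <= p -> exists2 n : nat, (0 < n)%N &
  ((p / 16 * n%:R `^ p^-1)%:E <= Lnorm01 p (haar_sum p (nested_intervals n)))%E.
Proof.
move=> p2; have p1 : 1 < p by lra. have p0 : 0 < p by lra.
have [m m0 pm] : exists2 m, (0 < m)%N & forall j, (m <= j)%N -> 2 * p <= j%:R.
  exists (Num.truncn (2 * p)).+1 => // j mj; apply: ltW.
  by apply: lt_le_trans (truncnS_gt (2 * p)) _; rewrite ler_nat.
exists m.*2; first by rewrite double_gt0.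
rewrite Lnorm01_nested// lee_fin; set r := haar_ratio p.
have r0 : 0 <= r by exact: ltW (haar_ratio_gt0 p).
have c0 : 0 <= 2^-1 :> R by rewrite invr_ge0.
have le1 : m.*2%:R / 4 * (p / 4) `^ p <= 2^-1 ^+ m.*2 * geom_sum r m.*2 `^ p +
  \sum_(j < m.*2) 2^-1 ^+ j.+1 * `|geom_sum r j - r ^+ j| `^ p.
  apply: (@le_trans _ _ (\sum_(j < m.*2) 2^-1 ^+ j.+1 * `|geom_sum r j - r ^+ j| `^
    p)); last first.
    by rewrite lerDr mulr_ge0 ?exprn_ge0 ?powR_ge0.
  rewrite -(big_mkord xpredT (fun j => 2^-1 ^+ j.+1 * `|geom_sum r j - r ^+ j| `^
    p)).
  rewrite (@big_cat_nat _ _ _ m) //=; last by rewrite -addnn leq_addr.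
  apply: (@le_trans _ _ (\sum_(m <= j < m.*2) 2^-1 * (p / 4) `^ p)).
    rewrite big_const_nat iter_addr_0 -addnn addnK natrD -[X in _ <= X]mulr_natr;
      lra.
  apply: ler_wpDl.
    by apply: sumr_ge0 => j _; rewrite mulr_ge0 ?exprn_ge0 ?powR_ge0.
  apply: ler_sum_nat => j /andP[mj _].
  by apply: nested_term_lower => //; exact: pm.
have n0 : 0 <= m.*2%:R / 4 :> R by rewrite divr_ge0.
have h4 : 0 <= p / 4 by rewrite divr_ge0// ltW.
apply: (@le_trans _ _ ((m.*2%:R / 4 * (p / 4) `^ p) `^ p^-1)); last first.
  apply: ge0_ler_powR => //; rewrite ?nnegrE ?mulr_ge0 ?powR_ge0//.
    by rewrite invr_ge0 ltW.
  by apply: le_trans le1; rewrite mulr_ge0 ?powR_ge0.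
have q4' : 0 <= 4^-1 :> R by rewrite invr_ge0.
rewrite (powRM _ n0 (powR_ge0 _ _)) -powRrM mulfV ?gt_eqF// powRr1// (powRM _
  (ler0n _ _) q4').
have q4 : 4^-1 <= 4^-1 `^ p^-1 :> R.
  apply: ger1_powR; first by apply/andP; split; lra.
  by rewrite invf_le1// ltW.
have x0 := powR_ge0 (m.*2%:R : R) p^-1.
have := ler_wpM2l (mulr_ge0 x0 h4) q4; lra.
Qed.

(** (r - 1) times the difference equals r^j (2 - r) - 1, and 2 - r <= 2 / q by
    [haar_ratioM] and [haar_ratio_le] for q: this is the cancellation near
    p = 1. *)
Lemma nested_term_upper p j : 1 < p -> p <= 2 ->
  2^-1 ^+ j.+1 * `|geom_sum (haar_ratio p) j - haar_ratio p ^+ j| `^ p <=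
  2^-1 * (16 / conj_exponent p) `^ p + 2^-1 ^+ j.+1 * 64.
Proof.
move=> p1 p2; have p0 : 0 < p by lra.
have [q1 pq _] := conj_exponentP p1; set q := conj_exponent p in q1 pq *.
set r := haar_ratio p; have [r1 r2] := haar_ratio_bounds p1; rewrite -/r in r1 r2.
have r0 : 0 < r by lra.
have q0 : 0 < q by lra.
have rl : 5 / 4 <= r.
  apply: le_trans (haar_ratio_ge p0).
  have : 4^-1 <= (2 * p)^-1 by rewrite lef_pV2 ?posrE ?mulr_gt0//; lra.
  lra.
have r2q : 2 - r <= 2 / q.
  have h1 := haar_ratioM pq; rewrite -/r in h1.
  have h2 := haar_ratio_le q1.
  have h3 : r * haar_ratio q <= r * (1 + q^-1) by rewrite ler_pM2l.
  have h4 : r * q^-1 <= 2 * q^-1 by rewrite ler_pM2r// invr_gt0.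
  lra.
have X0 : 0 < r ^+ j by rewrite exprn_gt0.
have key : `|geom_sum r j - r ^+ j| <= 8 / q * r ^+ j + 4.
  have e : (geom_sum r j - r ^+ j) * (r - 1) = r ^+ j * (2 - r) - 1.
    by rewrite mulrBl geom_sumE; ring.
  have h1 : `|geom_sum r j - r ^+ j| * (r - 1) <= r ^+ j * (2 / q) + 1.
    rewrite -[X in _ * X](@ger0_norm _ (r - 1)); last by lra.
    rewrite -normrM e; apply: le_trans (ler_normB _ _) _; rewrite normr1 lerD2r.
    rewrite ger0_norm; last by apply: mulr_ge0; [exact: ltW|lra].
    by rewrite ler_pM2l.
  have h2 : `|geom_sum r j - r ^+ j| * 4^-1 <= `|geom_sum r j - r ^+ j| * (r - 1).
    by rewrite ler_wpM2l//; lra.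
  have -> : 8 / q * r ^+ j = 4 * (r ^+ j * (2 / q)) by field; rewrite gt_eqF.
  lra.
have a0 : 0 <= 16 / q by rewrite divr_ge0// ltW.
have aX : 0 <= 16 / q * r ^+ j by rewrite mulr_ge0// ltW.
have e64 : 8 `^ p <= 64 :> R.
  apply: (@le_trans _ _ (8 `^ 2%:R)); first by apply: ler_powR; lra.
  by rewrite powR_mulrn// expr2; lra.
have key2 : `|geom_sum r j - r ^+ j| `^ p <= (16 / q * r ^+ j) `^ p + 64.
  have mono (y : R) : 0 <= y -> `|geom_sum r j - r ^+ j| <= y ->
    `|geom_sum r j - r ^+ j| `^ p <= y `^ p.
    by move=> y0 h; apply: ge0_ler_powR; rewrite ?nnegrE// ltW.
  have [h|h] := leP (8 / q * r ^+ j) 4.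
    have := mono 8 (ler0n _ 8); have : 0 <= (16 / q * r ^+ j) `^ p := powR_ge0 _ _.
    move=> h1 h2; have {}h2 := h2 ltac:(lra); lra.
  have h1 := mono _ aX ltac:(lra); lra.
apply: (@le_trans _ _ (2^-1 ^+ j.+1 * ((16 / q * r ^+ j) `^ p + 64))).
  by rewrite ler_wpM2l// exprn_ge0.
rewrite mulrDr lerD2r (powRM _ a0 (ltW X0)) exprS -mulrA ler_wpM2l//.
by rewrite mulrCA haar_ratioX// mulr1.
Qed.

Lemma sum_halves n : \sum_(j < n) 2^-1 ^+ j.+1 <= 1 :> R.
Proof.
have -> : \sum_(j < n) 2^-1 ^+ j.+1 = 1 - 2^-1 ^+ n :> R.
  elim: n => [|n IH]; first by rewrite big_ord0 expr0 subrr.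
  by rewrite big_ord_recr /= IH exprS; lra.
by rewrite lerBlDr lerDl exprn_ge0.
Qed.

(** For n at least 80 q^p the bounded contributions, at most 80 in total, do not
    exceed n (16 / q)^p / 2. *)
Lemma Lnorm01_nested_upper p : 1 < p -> p <= 2 -> exists2 n : nat, (0 < n)%N &
  (Lnorm01 p (haar_sum p (nested_intervals n)) <=
   (16 / conj_exponent p * n%:R `^ p^-1)%:E)%E.
Proof.
move=> p1 p2; have p0 : 0 < p by lra.
have [q1 pq _] := conj_exponentP p1.
have term j := @nested_term_upper p j p1 p2.
set q := conj_exponent p in q1 pq term *.
set r := haar_ratio p in term *; have [r1 r2] := haar_ratio_bounds p1;
  rewrite -/r in r1 r2.
have q0 : 0 < q by lra.
have [n n0 nq] : exists2 n, (0 < n)%N & 80 * q `^ p <= n%:R.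
  by exists (Num.truncn (80 * q `^ p)).+1 => //; apply: ltW; exact: truncnS_gt.
exists n => //; rewrite Lnorm01_nested// lee_fin -/r.
have a0 : 0 <= 16 / q by rewrite divr_ge0// ltW.
have rX0 : 0 <= r ^+ n by rewrite exprn_ge0//; lra.
have rl : 4^-1 <= r - 1.
  have := haar_ratio_ge p0; rewrite -/r.
  have : 4^-1 <= (2 * p)^-1 by rewrite lef_pV2 ?posrE ?mulr_gt0//; lra.
  lra.
have g0 : 0 <= geom_sum r n by apply: sumr_ge0 => i _; rewrite exprn_ge0//; lra.
have h1 : 2^-1 ^+ n * geom_sum r n `^ p <= 16.
  have gr : geom_sum r n <= 4 * r ^+ n.
    have := ler_wpM2l g0 rl; rewrite geom_sumE; lra.
  have : geom_sum r n `^ p <= (4 * r ^+ n) `^ p.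
    by apply: ge0_ler_powR; rewrite ?nnegrE ?mulr_ge0// ltW.
  rewrite powRM// => h; apply: (@le_trans _ _ (2^-1 ^+ n * (4 `^ p * (r ^+ n) `^
    p))).
    by rewrite ler_wpM2l// exprn_ge0.
  rewrite mulrCA haar_ratioX// mulr1; apply: (@le_trans _ _ (4 `^ 2%:R)).
    by apply: ler_powR; lra.
  by rewrite powR_mulrn// expr2; lra.
have h2 : \sum_(j < n) 2^-1 ^+ j.+1 * `|geom_sum r j - r ^+ j| `^ p <=
    n%:R * (2^-1 * (16 / q) `^ p) + 64.
  apply: le_trans (ler_sum _ (fun (j : 'I_n) _ => term j)) _.
  rewrite big_split /= sumr_const card_ord -[X in X + _ <= _]mulr_natl lerD2l.
  rewrite -mulr_suml; have := sum_halves n; lra.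
have h3 : 80 <= n%:R * (2^-1 * (16 / q) `^ p).
  have e16 : 16 <= 16 `^ p :> R by apply: le1r_powR; lra.
  have qp0 : 0 < q `^ p by rewrite powR_gt0.
  rewrite (powRM _ _ _) ?invr_ge0 ?(ltW q0)//.
  have -> : q^-1 `^ p = (q `^ p)^-1 by rewrite -powR_inv1 ?(ltW q0)// powRAC
    powR_inv1// ltW.
  rewrite !mulrA ler_pdivlMr//; apply: le_trans nq _; rewrite -mulrA ler_peMr//;
    lra.
have B0 : 0 <= 2^-1 ^+ n * geom_sum r n `^ p + \sum_(j < n) 2^-1 ^+ j.+1 *
  `|geom_sum r j - r ^+ j| `^ p.
  apply: addr_ge0; first by rewrite mulr_ge0 ?exprn_ge0 ?powR_ge0.
  by apply: sumr_ge0 => j _; rewrite mulr_ge0 ?exprn_ge0 ?powR_ge0.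
apply: (@le_trans _ _ ((n%:R * (16 / q) `^ p) `^ p^-1)).
  apply: ge0_ler_powR; rewrite ?nnegrE ?mulr_ge0 ?powR_ge0//.
    by rewrite invr_ge0 ltW.
  lra.
by rewrite (powRM _ (ler0n _ _) (powR_ge0 _ _)) -powRrM mulfV ?gt_eqF// powRr1//
  mulrC.
Qed.

End ExampleNorms.

(** * Existence of greedy orderings *)

Section GreedyOrderingExists.
Context {J : choiceType} (sigma : J -> nat) (tau : nat -> J).
Context (sigmaK : cancel sigma tau) (tauK : cancel tau sigma).
Context (key : J -> nat) (s : seq J).
Context (key_finite : forall i j, (key i < key j)%N -> i \in s).

Let le i j := (key i < key j)%N || ((key i == key j) && (sigma i <= sigma j)%N).

(** [le] orders by [key] and breaks ties by [sigma]. *)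
Lemma lexi_min_notin (l : seq J) :
  exists j, j \notin l /\ forall k, k \notin l -> le j k.
Proof.
have [j0 j0l] : exists j, j \notin l.
  exists (tau (\max_(j <- l) sigma j).+1); apply/negP => h.
  have := @leq_bigmax_seq _ l xpredT sigma _ h isT.
  by rewrite tauK ltnn.
pose P n := `[< exists2 j, j \notin l & key j = n >].
have exP : exists n, P n by exists (key j0); apply/asboolP; exists j0.
case: (ex_minnP exP) => n /asboolP[j1 j1l j1n] minn.
pose Q m := `[< exists2 j, j \notin l & key j = n /\ sigma j = m >].
have exQ : exists m, Q m by exists (sigma j1); apply/asboolP; exists j1.
case: (ex_minnP exQ) => m /asboolP[j2 j2l [j2n j2m]] minm.
exists j2; split=> // k kl; rewrite /le j2n.
have : (n <= key k)%N by apply: minn; apply/asboolP; exists k.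
rewrite leq_eqVlt => /orP[/eqP e|->//]; rewrite e eqxx ltnn /= j2m.
by apply: minm; apply/asboolP; exists k.
Qed.

(** Pick repeatedly the least element not yet chosen. Nothing is missed, because
    every element has finitely many predecessors: those of smaller key lie in [s],
    those of equal key have a smaller value of [sigma]. *)
Lemma lexi_enumeration : exists rho : nat -> J,
  [/\ injective rho, (forall m n, (m <= n)%N -> le (rho m) (rho n)) &
      forall j, exists n, rho n = j].
Proof.
have [pk hpk] := choice lexi_min_notin.
pose pre n := iter n (fun l => pk l :: l) [::].
pose rho n := pk (pre n).
have mem_pre n m : (m < n)%N -> rho m \in pre n.
  elim: n => // n IH; rewrite ltnS leq_eqVlt => /predU1P[->|mn].
    by rewrite /= mem_head.
  by rewrite /= in_cons IH ?orbT.
have pre_mem n j : j \in pre n -> exists m, rho m = j.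
  elim: n => // n IH; rewrite /= in_cons => /predU1P[->|/IH//].
  by exists n.
have sub_pre m n j : (m <= n)%N -> j \in pre m -> j \in pre n.
  elim: n => [|n IH]; first by rewrite leqn0 => /eqP->.
  rewrite leq_eqVlt => /predU1P[->//|mn jm].
  by rewrite /= in_cons IH ?orbT.
have rho_lt m n : (m < n)%N -> rho m <> rho n.
  by move=> mn e; have := (hpk (pre n)).1; rewrite -/(rho n) -e mem_pre.
have rho_inj : injective rho.
  by move=> m n e; case: (ltngtP m n) => // /rho_lt => [|/(_ (esym e))];
    [move/(_ e)|].
exists rho; split => //.
  move=> m n mn; apply: (hpk (pre m)).2; apply/negP => h.
  by have := (hpk (pre n)).1; rewrite (sub_pre m n).
move=> j; apply: contrapT => nj.
have jpre n : j \notin pre n by apply/negP => /pre_mem.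
have lej n : le (rho n) j := (hpk (pre n)).2 _ (jpre n).
pose L := s ++ [seq tau n | n <- iota 0 (sigma j).+1].
have inL n : rho n \in L.
  rewrite mem_cat; have /orP[/key_finite->//|/andP[_ h]] := lej n.
  apply/orP; right; apply/mapP; exists (sigma (rho n)); last by rewrite sigmaK.
  by rewrite mem_iota /= add0n ltnS.
have := @uniq_leq_size _ [seq rho n | n <- iota 0 (size L).+1] L.
rewrite map_inj_uniq ?iota_uniq// => /(_ isT) h.
have : (size [seq rho n | n <- iota 0 (size L).+1] <= size L)%N.
  by apply: h => x /mapP[n _ ->]; exact: inL.
by rewrite size_map size_iota ltnn.
Qed.

Lemma greedy_ordering_exists (K : numFieldType) (c : J -> K) :
  (forall i j, (key i <= key j)%N -> `|c j| <= `|c i|) ->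
  (forall i j, `|c i| = `|c j| -> key i = key j) ->
  (forall j, c j != 0 -> j \in s) ->
  exists rho, is_greedy_ordering sigma c rho.
Proof.
move=> cmono ceq csupp; have [rho [inj rle rsurj]] := lexi_enumeration.
have fin : finite_set [set j | c j != 0].
  by apply: (@sub_finite_set _ _ [set` s]) => // j /= /csupp.
exists rho; split => //.
- move=> m n mn; apply: cmono; have := rle m n mn.
  by rewrite /le => /orP[/ltnW//|/andP[/eqP-> _]].
- move=> m n mn e; have := rle m n mn; rewrite /le (ceq _ _ e) ltnn eqxx /=.
  exact.
by move=> _; apply/seteqP; split => // j _; have [n <-] := rsurj j; exists n.
Qed.

End GreedyOrderingExists.

(** * The lower bound *)

Section LowerBound.
Context {R : realType} {F : scalar_kind}.
Local Notation mu := (lebesgue01 R).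
Local Notation T := (measurableTypeR R).
Local Notation K := (scalar_field R F).
Local Notation functions := (T -> K^o).

Lemma norm_scalar_of_real (r : R) :
  `|scalar_of_reim F r 0| = scalar_of_reim F `|r| 0 :> K.
Proof.
case: F => //=; rewrite normc_def /= expr0n addr0 sqrtr_sqr //.
Qed.

Lemma scalar_of_real_le (r s : R) : r <= s ->
  (scalar_of_reim F r 0 : K) <= scalar_of_reim F s 0.
Proof. by case: F => //= rs; rewrite lecE /= eqxx. Qed.

Lemma scalar_of_real_inj (r s : R) :
  (scalar_of_reim F r 0 : K) = scalar_of_reim F s 0 -> r = s.
Proof. by move=> /(f_equal (@scalar_re R F)); rewrite !scalar_reK. Qed.

Lemma scalar_im_of_real (r : R) : scalar_im (scalar_of_reim F r 0 : K) = 0.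
Proof. by case: F. Qed.

Definition haar_combination p (c : option dyadic ->
  R) (S : seq (option dyadic)) : functions :=
  \sum_(j <- S) (scalar_of_reim F (c j) 0 : K) *: (haar F p j : functions).

Lemma re_haar_combination p c S x :
  scalar_re (haar_combination p c S x) = \sum_(j <- S) c j * haar_real p j x.
Proof.
rewrite /haar_combination fct_sumE scalar_re_sum; apply: eq_bigr => j _.
by rewrite -[LHS]/(scalar_re (_ * scalar_of_reim F _ 0)) scalar_reM scalar_reK.
Qed.

Lemma im_haar_combination p c S x : scalar_im (haar_combination p c S x) = 0.
Proof.
rewrite /haar_combination fct_sumE scalar_im_sum big1// => j _.
by rewrite -[LHS]/(scalar_im (_ * scalar_of_reim F _ 0)) scalar_imM
  scalar_im_of_real mul0r.
Qed.

Lemma Lp_norm_haar_combination p c S : p != 0 ->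
  Lp_norm p (haar_combination p c S) =
  Lnorm01 p (fun x => \sum_(j <- S) c j * haar_real p j x).
Proof.
move=> _; rewrite Lp_normE /Lnorm01 unlock /=; congr (_ `^ _)%E;
  apply: eq_integral => x _.
rewrite /modulus scalar_absE im_haar_combination re_haar_combination.
by rewrite expr0n addr0 sqrtr_sqr normr_id.
Qed.

Lemma eq_haar_combination p c d S : (forall j, j \in S -> c j = d j) ->
  haar_combination p c S = haar_combination p d S.
Proof.
move=> cd; rewrite /haar_combination big_seq [RHS]big_seq.
by apply: eq_bigr => j jS; rewrite cd.
Qed.

Lemma haar_functional_combination p c S I : 1 < p -> uniq S ->
  haar_functional p I (haar_combination p c S) =
  scalar_of_reim F (if I \in S then c I else 0) 0.
Proof.
move=> p1 uS; rewrite -[LHS]scalar_of_reimK haar_functional_re haar_functional_im.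
have [_ h] := haar_inner_remainder (fun j => - c j) I p1 (intg_cst 0) uS.
have zero : haar_inner p I (fun=> 0) = 0.
  by rewrite /haar_inner (@eq_Rint _ _ (fun=> 0)) ?/Rint ?Rintegral_cst ?mul0r// =>
    x; rewrite mul0r.
congr (scalar_of_reim F _ _).
  rewrite (_ : re_part _ = (fun x => 0 - \sum_(j <- S) - c j * haar_real p j x)).
    by rewrite h zero sub0r; case: ifP => _; rewrite ?opprK ?oppr0.
  apply/funext => x; rewrite /re_part re_haar_combination sub0r -sumrN.
  by apply: eq_bigr => j _; rewrite mulNr opprK.
rewrite (_ : im_part _ = fun=> 0)//.
by apply/funext => x; rewrite /im_part im_haar_combination.
Qed.

Lemma measurable_haar_combination p c S : p != 0 ->
  measurable_fun setT (fun x : T => \sum_(j <- S) c j * haar_real p j x : R).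
Proof.
move=> p0; apply: measurable_sum => I; apply: measurable_funM => //.
exact: measurable_haar.
Qed.

Lemma haar_combination_Lp p c S : 1 < p -> Lp_space p (haar_combination p c S).
Proof.
move=> p1; have p0 : p != 0 by rewrite gt_eqF//; lra.
split.
- rewrite (_ : (fun x => _) = (fun x => \sum_(j <- S) c j * haar_real p j x)).
    exact: measurable_haar_combination.
  by apply/funext => x; rewrite re_haar_combination.
- rewrite (_ : (fun x => _) = (fun=> 0)); first exact: measurable_cst.
  by apply/funext => x; rewrite im_haar_combination.
have [N SN] := haar_level_bound S.
rewrite Lp_norm_haar_combination// (step_haar_sum c p0 SN) Lnorm01_step ?ltry//;
  lra.
Qed.

(** Take coefficients 2 on B1 and 1 on B2. The greedy algorithm removes B1 first,
    whatever the tie-breaking rule is, while the competitor removes B2. *)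
Lemma greedy_bound_disjoint p sigma C (B1 B2 : seq (option dyadic)) :
  1 < p -> bijective sigma -> uniq B1 -> uniq B2 -> size B1 = size B2 ->
  (forall I, I \in B1 -> I \notin B2) -> 0 <= C ->
  greedy_bound (@Lp_space R F p) (@Lp_norm R F p) (haar F p) (haar_functional p)
    sigma C ->
  (Lnorm01 p (haar_sum p B2) <= (2 * C)%:E * Lnorm01 p (haar_sum p B1))%E.
Proof.
move=> p1 [tau sigmaK tauK] u1 u2 sz dis C0 gb.
have p0 : p != 0 by rewrite gt_eqF//; lra.
have dis' I : I \in B2 -> I \notin B1 by move=> I2; apply/negP => /dis; rewrite I2.
pose c I : R := if I \in B1 then 2 else 1.
pose v I : R := if I \in B1 ++ B2 then c I else 0.
pose key I : nat := if I \in B1 then 0%N else if I \in B2 then 1%N else 2%N.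
have u12 : uniq (B1 ++ B2).
  by rewrite cat_uniq u1 u2 andbT /=; apply/hasPn => I /dis'.
pose f := haar_combination p c (B1 ++ B2).
have fE : (haar_functional p ^~ f) = (fun I => scalar_of_reim F (v I) 0 : K).
  by apply/funext => I; rewrite /f haar_functional_combination.
have v0 I : 0 <= v I by rewrite /v /c; do 2 case: ifP => _ //.
have vkey I : v I = (2 - key I)%N%:R.
  rewrite /v /key /c mem_cat; case: (I \in B1) => //=.
  by case: (I \in B2).
have key2 I : (key I <= 2)%N by rewrite /key; case: ifP => // _; case: ifP.
have [rho gr] : exists rho, is_greedy_ordering sigma (fun I =>
  scalar_of_reim F (v I) 0 : K) rho.
  apply: (@greedy_ordering_exists _ sigma tau sigmaK tauK key (B1 ++ B2)).
  - move=> i j ij; have := leq_trans ij (key2 j); rewrite /key mem_cat.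
    by case: (i \in B1); case: (i \in B2).
  - move=> i j ij; rewrite !norm_scalar_of_real !ger0_norm//;
    apply: scalar_of_real_le.
    by rewrite !vkey ler_nat leq_sub2l.
  - move=> i j; rewrite !norm_scalar_of_real !ger0_norm// => /scalar_of_real_inj.
    rewrite !vkey => /eqP; rewrite eqr_nat => /eqP; have := key2 i; have := key2 j;
      lia.
  - move=> j; apply: contraNT => jn; rewrite /v (negbTE jn).
    by case: F.
set n := size B1.
have rho_inj : injective rho by case: gr.
have pB1 : perm_eq (prefix rho n) B1.
  apply: uniq_perm => //; first exact: prefix_uniq.
  have sub : {subset B1 <= prefix rho n}.
    move=> b bB; apply/negPn/negP => bn.
    have [g gp gB] : exists2 g, g \in prefix rho n & g \notin B1.
      apply: contrapT => nex.
      have sub' : {subset prefix rho n <= B1}.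
        by move=> g gp; apply/negPn/negP => gB; apply: nex; exists g.
      have e : prefix rho n =i B1.
        by have [] := uniq_min_size (prefix_uniq n rho_inj) sub' _;
          rewrite ?size_prefix.
      by rewrite e bB in bn.
    have := greedy_prefix_dominates gr gp bn.
    rewrite !norm_scalar_of_real !ger0_norm// => h.
    have : scalar_re (scalar_of_reim F (v b) 0 : K) <= scalar_re (scalar_of_reim F
      (v g) 0 : K).
      have := scalar_abs_homo (z := scalar_of_reim F (v b) 0) (w :=
        scalar_of_reim F (v g) 0).
      rewrite !norm_scalar_of_real !ger0_norm// => /(_ h).
      by rewrite /scalar_abs !norm_scalar_of_real !ger0_norm.
    rewrite !scalar_reK !vkey ler_nat /key bB (negbTE gB).
    by case: (g \in B2).
  have e : B1 =i prefix rho n.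
    by have [] := uniq_min_size u1 sub _; rewrite ?size_prefix.
  by move=> I; rewrite e.
pose A := [fset I in B2]%fset.
have pA : perm_eq A B2.
  by apply: uniq_perm => // I; rewrite inE.
have An : #|` A| = n by rewrite /n sz; exact: perm_size.
rewrite -fE in gr.
have := gb n f rho A (fun I => scalar_of_reim F (c I) 0) (haar_combination_Lp c _
  p1) gr An.
rewrite greedy_sumE (perm_big _ pB1) (perm_big _ pA) /=.
have fsplit : f = haar_combination p c B1 + haar_combination p c B2.
  by rewrite /f /haar_combination big_cat.
have -> : \sum_(j <- B1) haar_functional p j f *: (haar F p j : functions) =
  haar_combination p c B1.
  rewrite /haar_combination big_seq [RHS]big_seq; apply: eq_bigr => j j1;
    congr (_ *: _).
  by rewrite /f haar_functional_combination// mem_cat j1.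
rewrite -/(haar_combination p c B2).
rewrite {1}fsplit addrC addKr fsplit addrK.
rewrite (@eq_haar_combination p c (fun=> 1) B2); last first.
  by move=> j /dis' /negbTE j1; rewrite /c j1.
rewrite !Lp_norm_haar_combination// => h.
apply: le_trans h _.
rewrite mulrC EFinM -muleA.
apply: lee_wpmul2l; first by rewrite lee_fin.
have [N SN] := haar_level_bound B1.
rewrite (step_haar_sum c p0 SN) /haar_sum (step_haar_sum (fun=> 1) p0 SN).
have pp : 0 < p by lra.
apply: Lnorm01_le_scaled => //; rewrite ?norm_powR_step//; try exact: intg_step.
rewrite !Rint_step -level_meanZ; apply: ler_level_mean => k _.
rewrite -powRM//; apply: ge0_ler_powR; rewrite ?nnegrE ?mulr_ge0 ?(ltW pp)//.
rewrite -[X in _ <= X * _](@ger0_norm R 2)// -normrM mulr_sumr big_seq.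
rewrite [X in _ <= `|X|]big_seq (eq_bigr (fun I =>
  2 * (1 * (haar_ratio p ^+ (haar_level I).-1 * haar_cell N I k))))//.
by move=> I I1; rewrite /c I1 mul1r.
Qed.

End LowerBound.

(** For p >= 2 let the greedy algorithm remove the disjoint family and keep the
    nested one, for p < 2 the other way round. *)
Lemma haar_greedy_constant_ge (R : realType) (F : scalar_kind) (p : R)
    (sigma : option dyadic -> nat) : 1 < p -> bijective sigma ->
  ((32^-1 * Num.max p (conj_exponent p))%:E <= @haar_greedy_constant R F p sigma)%E.
Proof.
move=> p1 bij; have [q1 pq pqD] := conj_exponentP p1.
have pp : 0 < p by lra.
apply: le_ereal_inf_tmp => _ [C [C1 gb] <-]; rewrite lee_fin.
have C0 : 0 <= C by lra.
have pos n : (0 < n)%N -> 0 < n%:R `^ p^-1 :> R by move=> n0;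
  rewrite powR_gt0// ltr0n.
have [p2|p2] := leP 2 p.
  have [n n0 hn] := Lnorm01_nested_lower p2.
  have := greedy_bound_disjoint p1 bij (spread_uniq n) (nested_uniq n) _ _ C0 gb.
  rewrite size_spread size_nested => /(_ erefl) h.
  have {}h := h (fun I Is => contraL (@nested_spread_disjoint n I) Is).
  have := le_trans hn h; rewrite Lnorm01_spread// -EFinM lee_fin ler_pM2r ?pos// =>
    h2.
  have qp : conj_exponent p <= p.
    by rewrite /conj_exponent ler_pdivrMr; [rewrite ler_peMr|]; lra.
  rewrite (max_idPl qp); lra.
have [n n0 hn] := Lnorm01_nested_upper p1 (ltW p2).
have := greedy_bound_disjoint p1 bij (nested_uniq n) (spread_uniq n) _
  (@nested_spread_disjoint n) C0 gb.
rewrite size_spread size_nested => /(_ erefl) h.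
have C2 : (0 <= (2 * C)%:E)%E by rewrite lee_fin mulr_ge0.
have := le_trans h (lee_wpmul2l C2 hn).
rewrite Lnorm01_spread// -EFinM lee_fin mulrA -[X in X <= _]mul1r ler_pM2r ?pos//.
rewrite mulrA ler_pdivlMr; last by lra.
rewrite mul1r => h2.
have pq' : p <= conj_exponent p.
  by rewrite /conj_exponent ler_pdivlMr; [rewrite ler_piMr|]; lra.
rewrite (max_idPr pq'); lra.
Qed.

Theorem theorem1p3 (R : realType) (F : scalar_kind) :
  exists c C : R, 0 < c /\ c <= C /\
    forall p : R, 1 < p ->
    forall sigma : option dyadic -> nat, bijective sigma ->
      ((c * Num.max p (conj_exponent p))%:E
         <= @haar_greedy_constant R F p sigma)%E /\
      (@haar_greedy_constant R F p sigma
         <= (C * Num.max p (conj_exponent p))%:E)%E.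
Proof.
exists 32^-1, 172; split; [lra|split; [lra|]] => p p1 sigma bij; split.
  exact: haar_greedy_constant_ge.
exact: haar_greedy_constant_le.
Qed.
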